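(* Let $(N,g_N)$ be an $n$-dimensional Riemannian manifold, $I\subseteq\mathbb{R}$ an open interval, $b:I\to(0,+\infty)$ smooth, and let $M=N\times I$ carry the metric $g=b(t)^2g_N-dt^2$. Let $X=b(t)\partial_t$. Let $\Omega\subseteq N$ be open, precompact and connected, let $u\in C^2(\Omega,I)$, and let $\varepsilon>0$, $u_t$ and $F_t:\Omega\to M$, $F_t(x)=(x,u_t(x))$, $t\in(-\varepsilon,\varepsilon)$, be as defined in the context, with $F_0^*g$ non-degenerate. Then the family $\{F_t: t\in(-\varepsilon,\varepsilon)\}$ defines an $X$-soliton if, and only if, for each $x\in\Omega$ and $t\in(-\varepsilon,\varepsilon)$, $$\operatorname{div}\left(\frac{\nabla u}{(b\circ u)\,W}\right)(x)=\frac{1}{W(x)}\left[b(u_t(x))^2-n\,b'(u_t(x))\right].$$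
   Context: The flow of $X$ is $\Phi_t(x,s)=(x,A(s,t))$ with $A(s,0)=s$ and $\frac{\partial A}{\partial t}(s,t)=b(A(s,t))$. The number $\varepsilon>0$ is chosen such that $u_t(x):=A(u(x),t)$ is defined for all $x\in\Omega$ and $t\in(-\varepsilon,\varepsilon)$, and (shrinking if necessary) $F_t^*g$ is non-degenerate for these $t$. $\nabla u$, $|\nabla u|$ and $\operatorname{div}$ are taken with respect to $g_N$. The function $\hat\varepsilon=\operatorname{sign}\left(\frac{|\nabla u|^2}{(b\circ u)^2}-1\right)$ takes values in $\{\pm1\}$, and $$W(x)=\sqrt{\hat\varepsilon(x)\left(\frac{|\nabla u(x)|^2}{b(u(x))^2}-1\right)}.$$ The family $\{F_t\}$ (or $F_0$) is called an $X$-soliton if for every $x\in\Omega$ and $t\in(-\varepsilon,\varepsilon)$, $b(u_t(x))\,\partial_t^{\perp}(x,u_t(x))=\vec H_t(x,u_t(x))$, where $\perp$ is the $g$-orthogonal projection to the normal bundle of $F_t$ and $\vec H_t=\sum_i\varepsilon_i\left(\nabla^M_{(F_t)_*e_i}(F_t)_*e_i\right)^\perp$ is the mean curvature vector of $F_t$ (no division by the dimension), with $(e_i)$ a local $F_t^*g$-orthonormal frame satisfying $g((F_t)_*e_i,(F_t)_*e_j)=\varepsilon_i\delta_{ij}$ and $\nabla^M$ the Levi-Civita connection of $(M,g)$. *)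

(* Defs.v *)
From mathcomp Require Import all_boot all_order all_algebra.
From mathcomp Require Import all_classical all_reals all_analysis.

Set Implicit Arguments.
Unset Strict Implicit.
Unset Printing Implicit Defensive.

Import Order.TTheory GRing.Theory Num.Theory.
Import numFieldNormedType.Exports.

Local Open Scope classical_set_scope.
Local Open Scope ring_scope.

(** * Functions of class C^k

    Meant for an open set [D] and finite-dimensional [U], where continuity of
    the differential amounts to continuity of all directional derivatives. *)

Fixpoint Ck (R : realType) (U V : normedModType R) (k : nat) (D : set U)
    (f : U -> V) : Prop :=
  if k is k'.+1 then
    (forall x, D x -> differentiable f x) /\ (forall v, Ck k' D ('D_v f))
  else forall x, D x -> {for x, continuous f}.

Definition smooth (R : realType) (U V : normedModType R) (D : set U)
    (f : U -> V) : Prop :=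
  forall k, Ck k D f.

(** * Pseudo-Riemannian geometry in coordinates

    Vectors are row vectors of components.  [G y] is the matrix
    (g_ij(y)) of a metric, and [f] is a map into the coordinate domain of [G];
    the rows of ['J f y] are the coordinate vectors of [f]. *)

Section Coordinates.
Variable R : realType.

Definition gdot (m : nat) (G : 'M[R]_m) (v w : 'rV[R]_m) : R :=
  (v *m G *m w^T) 0 0.

Definition nondegenerate_mx (m : nat) (G : 'M[R]_m) : Prop :=
  forall v, (forall w, gdot G v w = 0) -> v = 0.

Definition basis_vec (m : nat) (i : 'I_m) : 'rV[R]_m := delta_mx 0 i.

(* Gamma^a_bc of the Levi-Civita connection. *)
Definition christoffel (m : nat) (G : 'rV[R]_m -> 'M[R]_m) (y : 'rV[R]_m)
    (a b c : 'I_m) : R :=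
  let dG e i j := 'D_(basis_vec e) (fun z => G z i j) y in
  2^-1 * \sum_d invmx (G y) a d * (dG b d c + dG c d b - dG d b c).

(* Levi-Civita derivative at [y], in the direction [v], of a vector field [Y]
   along [f] (i.e. [Y z] is a tangent vector at [f z]). *)
Definition cov_along (n m : nat) (G : 'rV[R]_m -> 'M[R]_m)
    (f : 'rV[R]_n -> 'rV[R]_m) (v : 'rV[R]_n) (Y : 'rV[R]_n -> 'rV[R]_m)
    (y : 'rV[R]_n) : 'rV[R]_m :=
  'D_v Y y + \row_a \sum_b \sum_c
     christoffel G (f y) a b c * ('D_v f y) 0 b * (Y y) 0 c.

Definition pullback (n m : nat) (G : 'rV[R]_m -> 'M[R]_m)
    (f : 'rV[R]_n -> 'rV[R]_m) (y : 'rV[R]_n) : 'M[R]_n :=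
  'J f y *m G (f y) *m ('J f y)^T.

(* Projection onto the G-orthogonal complement of the image of the
   differential, along that image. *)
Definition normal_proj (n m : nat) (G : 'rV[R]_m -> 'M[R]_m)
    (f : 'rV[R]_n -> 'rV[R]_m) (y : 'rV[R]_n) (w : 'rV[R]_m) : 'rV[R]_m :=
  w *m proj_mx (kermx (G (f y) *m ('J f y)^T)) <<'J f y>>%MS.

(* The frame is only required to be C^1: for [f] of class C^2 the pulled-back
   metric itself is no better than C^1. *)
Definition local_orthonormal_frame (n m : nat) (G : 'rV[R]_m -> 'M[R]_m)
    (f : 'rV[R]_n -> 'rV[R]_m) (y : 'rV[R]_n)
    (E : 'I_n -> 'rV[R]_n -> 'rV[R]_n) (eps : 'I_n -> R) : Prop :=
  (forall i, eps i = 1 \/ eps i = -1) /\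
  exists U : set 'rV[R]_n, [/\ open_nbhs y U,
    forall i, Ck 1 U (E i) &
    forall z, U z -> forall i j,
      gdot (G (f z)) ('D_(E i z) f z) ('D_(E j z) f z) = eps i *+ (i == j)].

Definition is_mean_curvature_vector (n m : nat) (G : 'rV[R]_m -> 'M[R]_m)
    (f : 'rV[R]_n -> 'rV[R]_m) (y : 'rV[R]_n) (H : 'rV[R]_m) : Prop :=
  exists (E : 'I_n -> 'rV[R]_n -> 'rV[R]_n) (eps : 'I_n -> R),
    local_orthonormal_frame G f y E eps /\
    H = \sum_i eps i *:
          normal_proj G f y (cov_along G f (E i y) (fun z => 'D_(E i z) f z) y).

End Coordinates.

(** * Riemannian manifolds *)

(* [cinv] is only meaningful on the image of [cdom]. *)
Record chart (R : realType) (n : nat) (N : topologicalType) := Chart {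
  cdom : set N;
  cmap : N -> 'rV[R]_n;
  cinv : 'rV[R]_n -> N;
  cdom_open : open cdom;
  cimg_open : open (cmap @` cdom);
  cmap_continuous : forall x, cdom x -> {for x, continuous cmap};
  cinv_continuous : forall y, (cmap @` cdom) y -> {for y, continuous cinv};
  cmapK : forall x, cdom x -> cinv (cmap x) = x }.

Definition transition (R : realType) (n : nat) (N : topologicalType)
    (phi psi : chart R n N) : 'rV[R]_n -> 'rV[R]_n :=
  fun y => cmap psi (cinv phi y).

Definition overlap (R : realType) (n : nat) (N : topologicalType)
    (phi psi : chart R n N) : set 'rV[R]_n :=
  cmap phi @` (cdom phi `&` cdom psi).

(* The metric is given by its component matrices in the charts of the atlas,
   subject to the transformation law of a (0,2)-tensor.  [chart_at] is a choice
   of a chart around each point; the notions below that are evaluated in it do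
   not depend on this choice. *)
Record riemannian_manifold (R : realType) (n : nat) := RiemannianManifold {
  point :> topologicalType;
  point_hausdorff : hausdorff_space point;
  point_second_countable : @second_countable point;
  atlas : set (chart R n point);
  chart_at : point -> chart R n point;
  chart_at_atlas : forall x, atlas (chart_at x);
  chart_at_dom : forall x, cdom (chart_at x) x;
  atlas_smooth : forall phi psi, atlas phi -> atlas psi ->
    smooth (overlap phi psi) (transition phi psi);
  metric : chart R n point -> 'rV[R]_n -> 'M[R]_n;
  metric_smooth : forall phi, atlas phi ->
    smooth (cmap phi @` cdom phi) (metric phi);
  metric_sym : forall phi y, atlas phi -> (cmap phi @` cdom phi) y ->
    (metric phi y)^T = metric phi y;
  metric_pos : forall phi y, atlas phi -> (cmap phi @` cdom phi) y ->
    forall v, v != 0 -> 0 < gdot (metric phi y) v v;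
  metric_transition : forall phi psi y, atlas phi -> atlas psi ->
    overlap phi psi y ->
    metric phi y = pullback (metric psi) (transition phi psi) y }.

Section Manifold.
Variables (R : realType) (n : nat) (N : riemannian_manifold R n).

Definition CkN (k : nat) (Omega : set N) (u : N -> R) : Prop :=
  forall phi, atlas phi ->
    Ck k (cmap phi @` (cdom phi `&` Omega)) (u \o cinv phi).

(* Components of a vector field in each chart, as functions of the
   coordinates. *)
Definition vector_field := chart R n N -> 'rV[R]_n -> 'rV[R]_n.

Definition scale_field (h : N -> R) (V : vector_field) : vector_field :=
  fun phi y => h (cinv phi y) *: V phi y.

Definition grad (u : N -> R) : vector_field :=
  fun phi y =>
    (\row_i 'D_(basis_vec R i) (u \o cinv phi) y) *m invmx (metric phi y).

Definition norm_grad_sq (u : N -> R) (x : N) : R :=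
  let phi := chart_at x in let y := cmap phi x in
  gdot (metric phi y) (grad u phi y) (grad u phi y).

(* The trace of the covariant differential of [V]. *)
Definition div (V : vector_field) (x : N) : R :=
  let phi := chart_at x in
  \sum_i (cov_along (metric phi) id (basis_vec R i) (V phi) (cmap phi x)) 0 i.

(** * The warped product N x I with metric b(t)^2 g_N - dt^2

    Its charts are the products [phi] x id, with coordinates
    [row_mx y t%:M]. *)

Section Warped.
Variable b : R -> R.

Definition warped_metric (phi : chart R n N) (z : 'rV[R]_(n + 1)) :
    'M[R]_(n + 1) :=
  block_mx ((b (rsubmx z 0 0)) ^+ 2 *: metric phi (lsubmx z)) 0 0 (-1)%:M.

Definition dt_vec : 'rV[R]_(n + 1) := row_mx 0 1%:M.

(* The map x |-> (x, u x) in the charts [phi] and [phi] x id. *)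
Definition graph (u : N -> R) (phi : chart R n N) (y : 'rV[R]_n) :
    'rV[R]_(n + 1) :=
  row_mx y (u (cinv phi y))%:M.

Definition graph_nondegenerate (Omega : set N) (u : N -> R) : Prop :=
  forall x, Omega x -> let phi := chart_at x in
    nondegenerate_mx (pullback (warped_metric phi) (graph u phi) (cmap phi x)).

Definition eps_hat (u : N -> R) (x : N) : R :=
  Num.sg (norm_grad_sq u x / b (u x) ^+ 2 - 1).

Definition W (u : N -> R) (x : N) : R :=
  Num.sqrt (eps_hat u x * (norm_grad_sq u x / b (u x) ^+ 2 - 1)).

(* [ut t x] is the height of F_t x = (x, ut t x). *)
Definition X_soliton (Omega : set N) (ut : R -> N -> R) (eps : R) : Prop :=
  forall x t, Omega x -> `|t| < eps ->
    let phi := chart_at x in let y := cmap phi x in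
    let G := warped_metric phi in let F := graph (ut t) phi in
    is_mean_curvature_vector G F y (b (ut t x) *: normal_proj G F y dt_vec).

End Warped.
End Manifold.

(* The curves [A s], for [s] in [S], are integral curves of b(t) d/dt in [I],
   defined (at least) for |t| < eps. *)
Definition is_flow (R : realType) (b : R -> R) (I S : set R)
    (A : R -> R -> R) (eps : R) : Prop :=
  forall s, S s -> A s 0 = s /\
    forall t, `|t| < eps -> I (A s t) /\ is_derive t 1 (A s) (b (A s t)).

(* Main.v *)
(* Fix t and write f = u_t.  In a chart, the graph of f has normal vector
   N = (grad f / b^2, 1) with <N, N> = q = |grad f|^2 / b^2 - 1, and the induced
   metric h = b^2 g - df (x) df is non-degenerate exactly when q <> 0.  Since
   <dt, N> = -1, the soliton equation says that -b is the h-trace of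
   <nabla_i d_j F, N> = - Hess f - b b' g + 2 (b'/b) df (x) df.
   As h^-1 = b^-2 (g^-1 - grad f (x) grad f / (b^2 q)), this reads
     Lap f - Hess f (grad f, grad f) / (b^2 q) + b b' (q + 1) / q = b^3 - n b b',
   whose left-hand side is b W div (grad f / (b W)), W = sqrt |q|.
   Finally an antiderivative B of 1/b gives B (A s t) = B s + t, so that u_t is
   C^2 with grad u_t = (b u_t / b u) grad u; hence |grad u_t| / b u_t, W and
   grad u_t / (b u_t W) do not depend on t. *)

Require Import Defs.
From mathcomp Require Import all_boot all_order all_algebra.
From mathcomp Require Import all_classical all_reals all_analysis.
From mathcomp Require Import ring lra.
Import Order.TTheory GRing.Theory Num.Theory.
Import numFieldNormedType.Exports.
Local Open Scope classical_set_scope.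
Local Open Scope ring_scope.

Set Implicit Arguments.
Unset Strict Implicit.
Unset Printing Implicit Defensive.

(** * Functions that are C^1 near a point *)

(** The height is only C^2, so the induced metric, its orthonormal frames and the gradient are only
    C^1. The calculus is therefore done with real functions that are C^1 near one point, a class
    closed under all operations that occur. A mean curvature vector is defined through the existence
    of a frame. One direction of the equivalence thus has to construct a C^1 frame for a metric of
    possibly indefinite signature; the other has to show that every frame gives the same trace. Two
    choices that vary with the point interfere with differentiation: [W] contains a sign and is
    computed at each [p] in the chart [chart_at p], whereas [div] differentiates in the single chart
    at [x]. The sign is locally constant and |grad f|^2 is independent of the chart, so near [x]
    both choices can be frozen. Finally, [A s t] is given only for [s] in the set of heights, which
    need not be open, so its regularity in [s] has no direct meaning. It is obtained by extending
    the time-t map to B^-1 (B s + t). *)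

Section C1Near.
Variables (R : realType) (V : normedModType R).

Lemma near_eq_continuous_for (U W : topologicalType) (f g : U -> W) (x : U) :
  (\forall y \near x, f y = g y) -> {for x, continuous f} ->
  {for x, continuous g}.
Proof.
move=> fg cf; rewrite /prop_for /continuous_at -(nbhs_singleton fg).
by apply: cvg_trans cf; apply: near_eq_cvg.
Qed.

(** The first-order expansion of [f] at [x] is also one for [g], and uniqueness of the differential
    identifies its linear part with the differential of [g]. *)
Lemma near_eq_differentiable (W : normedModType R) (f g : V -> W) x :
  (\forall y \near x, f y = g y) -> differentiable f x -> differentiable g x.
Proof.
move=> fg df.
have [cdf /eqaddoP fE] := (diff_locallyP x f).1 df.
have gE : g \o shift x = cst (g x) + 'd f x +o_ 0 id.
  have fg0 : \forall h \near 0, f (h + x) = g (h + x).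
    by move: fg; rewrite (near_shift 0 x) subr0.
  apply/eqaddoP => e e0; have := fE e e0; apply: filterS2 fg0 => h /=.
  by rewrite !fctE /= => ->; rewrite (nbhs_singleton fg).
apply/diff_locallyP; have -> := diff_unique cdf gE.
by split.
Qed.


Implicit Types (f g : V -> R) (x v : V).

(** A condition on the germ at [x]: no domain has to be carried along, and the condition spreads to
    neighbouring points. *)
Definition C1_near x f : Prop :=
  \forall y \near x,
    differentiable f y /\ forall v, {for y, continuous ('D_v f)}.

Lemma C1_near_differentiable x f : C1_near x f -> differentiable f x.
Proof. by move=> /nbhs_singleton[]. Qed.

Lemma C1_near_derivable x f v : C1_near x f -> derivable f x v.
Proof. by move=> /C1_near_differentiable /diff_derivable. Qed.

Lemma C1_near_continuous x f : C1_near x f -> {for x, continuous f}.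
Proof. by move=> /C1_near_differentiable /differentiable_continuous. Qed.

Lemma C1_near_near x f : C1_near x f -> \forall y \near x, C1_near y f.
Proof. exact: near_join. Qed.

Lemma C1_near_eq x f g :
  (\forall y \near x, f y = g y) -> C1_near x f -> C1_near x g.
Proof.
move=> /near_join fg; apply: filterS2 fg => y fg [df cf].
split=> [|v]; first exact: near_eq_differentiable fg df.
apply: near_eq_continuous_for (cf v).
by apply: filterS (near_join fg) => z; exact: near_eq_derive.
Qed.

Lemma C1_nearT x f :
  (forall y, differentiable f y /\ forall v, {for y, continuous ('D_v f)}) ->
  C1_near x f.
Proof. by move=> cf; exact: nearW. Qed.

Lemma C1_near_cst x (c : R) : C1_near x (fun=> c).
Proof.
apply: nearW => y; split=> [|v]; first exact: differentiable_cst.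
rewrite (_ : 'D_v _ = fun=> 0) ?funeqE => *; first exact: cst_continuous.
exact: derive_cst.
Qed.

Lemma C1_nearD x f g : C1_near x f -> C1_near x g ->
  C1_near x (fun z => f z + g z).
Proof.
move=> /near_join cf /near_join cg; apply: filterS2 cf cg => y cf cg.
have [df cdf] := nbhs_singleton cf; have [dg cdg] := nbhs_singleton cg.
split=> [|v]; first exact: (differentiableD df dg).
apply: (@near_eq_continuous_for _ _ (fun z => 'D_v f z + 'D_v g z)); last first.
  exact: (continuousD (cdf v) (cdg v)).
apply: filterS2 cf cg => z [/diff_derivable dfz _] [/diff_derivable dgz _].
by rewrite -deriveD.
Qed.

Lemma C1_nearM x f g : C1_near x f -> C1_near x g ->
  C1_near x (fun z => f z * g z).
Proof.
move=> /near_join cf /near_join cg; apply: filterS2 cf cg => y cf cg.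
have [df cdf] := nbhs_singleton cf; have [dg cdg] := nbhs_singleton cg.
split=> [|v]; first exact: (differentiableM df dg).
apply: (@near_eq_continuous_for _ _
  (fun z => f z * 'D_v g z + g z * 'D_v f z)); last first.
  by apply: continuousD; apply: continuousM => //;
    exact: differentiable_continuous.
apply: filterS2 cf cg => z [/diff_derivable dfz _] [/diff_derivable dgz _].
by apply/esym; rewrite -[LHS]/('D_v (f * g) z) deriveM.
Qed.

Lemma C1_nearN x f : C1_near x f -> C1_near x (fun z => - f z).
Proof.
move=> cf; apply: C1_near_eq (C1_nearM (C1_near_cst x (-1)) cf).
by apply: nearW => y; rewrite mulN1r.
Qed.

Lemma C1_nearB x f g : C1_near x f -> C1_near x g ->
  C1_near x (fun z => f z - g z).
Proof. by move=> cf cg; exact: (C1_nearD cf (C1_nearN cg)). Qed.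

Lemma C1_near_sum x (J : Type) (r : seq J) (P : pred J) (F : J -> V -> R) :
  (forall j, C1_near x (F j)) ->
  C1_near x (fun z => \sum_(j <- r | P j) F j z).
Proof.
move=> cF; elim: r => [|j r IH].
  by apply: C1_near_eq (C1_near_cst x 0); apply: nearW => y; rewrite big_nil.
case Pj: (P j); last first.
  by apply: C1_near_eq IH; apply: nearW => y; rewrite big_cons Pj.
apply: C1_near_eq (C1_nearD (cF j) IH).
by apply: nearW => y; rewrite big_cons Pj.
Qed.

Lemma C1_near_prod x (J : Type) (r : seq J) (P : pred J) (F : J -> V -> R) :
  (forall j, C1_near x (F j)) ->
  C1_near x (fun z => \prod_(j <- r | P j) F j z).
Proof.
move=> cF; elim: r => [|j r IH].
  by apply: C1_near_eq (C1_near_cst x 1); apply: nearW => y; rewrite big_nil.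
case Pj: (P j); last first.
  by apply: C1_near_eq IH; apply: nearW => y; rewrite big_cons Pj.
apply: C1_near_eq (C1_nearM (cF j) IH).
by apply: nearW => y; rewrite big_cons Pj.
Qed.

End C1Near.

Lemma derive_comp_real (R : realType) (V : normedModType R) (f : V -> R)
    (h : R -> R) (x v : V) :
  differentiable f x -> differentiable h (f x) ->
  'D_v (fun z => h (f z)) x = 'D_1 h (f x) * 'D_v f x.
Proof.
move=> df dh; rewrite [LHS](deriveE v (differentiable_comp df dh)).
rewrite diff_comp //= !deriveE // mulrC.
(* A linear map on the real line is multiplication by its value at 1. *)
by rewrite -[in LHS](mulr1 ('d f x v)); exact: linearZ.
Qed.

Lemma C1_near_comp (R : realType) (V : normedModType R) (f : V -> R)
    (h : R -> R) (x : V) :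
  C1_near x f -> C1_near (f x) h -> C1_near x (fun z => h (f z)).
Proof.
move=> cf ch; have cfx := C1_near_continuous cf.
have {}ch : \forall y \near x, C1_near (f y) h.
  exact: (cfx _ (near_join ch)).
move: cf => /near_join cf; apply: filterS2 cf (near_join ch) => y cf ch'.
have [df cdf] := nbhs_singleton cf.
have [dh cdh] := nbhs_singleton (nbhs_singleton ch').
have fc := differentiable_continuous df.
split=> [|v]; first exact: (differentiable_comp df dh).
apply: (@near_eq_continuous_for _ _
  (fun z => 'D_1 h (f z) * 'D_v f z)); last first.
  apply: continuousM => //.
  exact: (@continuous_comp _ _ _ f ('D_1 h) y fc (cdh 1)).
apply: filterS2 cf ch' => z [dfz _] /nbhs_singleton[dhz _].
by rewrite (derive_comp_real v dfz dhz).
Qed.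

Lemma C1_nearV (R : realType) (V : normedModType R) (f : V -> R) (x : V) :
  f x != 0 -> C1_near x f -> C1_near x (fun z => (f z)^-1).
Proof.
move=> f0 cf; apply: (C1_near_comp cf (h := GRing.inv)).
have ne0 : \forall y \near f x, y != 0.
  exact: (open_nbhs_nbhs (conj (@open_neq R 0) f0)).
move/near_join: ne0; apply: filterS => y ne0.
have y0 := nbhs_singleton ne0.
split=> [|v]; first exact: differentiable_Rinv.
apply: (@near_eq_continuous_for _ _ (fun z : R => - z ^- 2 * v)); last first.
  apply: continuousM; last exact: cst_continuous.
  apply: continuousN; apply: continuousV; first by rewrite expf_neq0.
  exact: exprn_continuous.
apply: filterS ne0 => z z0.
have := @deriveV R R id z v z0 (derivable_id (v := v)).
by rewrite derive_id => /esym.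
Qed.

Lemma C1_near_sqrt (R : realType) (V : normedModType R) (f : V -> R) (x : V) :
  0 < f x -> C1_near x f -> C1_near x (fun z => Num.sqrt (f z)).
Proof.
move=> f0 cf; apply: (C1_near_comp cf (h := Num.sqrt)).
have gt0 : \forall y \near f x, 0 < y.
  exact: (open_nbhs_nbhs (conj (@open_gt R 0) f0)).
move/near_join: gt0; apply: filterS => y gt0.
have y0 := nbhs_singleton gt0.
have ds (z : R) : 0 < z -> differentiable (Num.sqrt : R -> R) z.
  by move=> /is_derive1_sqrt[+ _] => /derivable1_diffP.
split=> [|v]; first exact: ds.
apply: (@near_eq_continuous_for _ _
    (fun z : R => v * (2 * Num.sqrt z)^-1)); last first.
  apply: continuousM; first exact: cst_continuous.
  apply: continuousV; first by rewrite mulf_neq0 // gt_eqF ?sqrtr_gt0.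
  apply: continuousM; first exact: cst_continuous.
  exact: sqrt_continuous.
apply: filterS gt0 => z z0.
rewrite -derive_sqrt // !deriveE; [|exact: ds..].
by rewrite -[in RHS](mulr1 v); apply/esym; exact: linearZ.
Qed.

(** * Matrix-valued maps that are C^1 near a point *)

Section C1Matrix.
Variables (R : realType) (V : normedModType R).

Lemma continuous_mx m n (M : V -> 'M[R]_(m, n)) x :
  (forall i j, {for x, continuous (fun z => M z i j)}) ->
  {for x, continuous M}.
Proof.
move=> cM; apply/cvgrPdist_le => e e0; near=> y.
rewrite /Num.Def.normr/= mx_normrE (bigmax_le _ (ltW e0)) //= => i _.
rewrite !mxE/=.
move: i; near: y; apply: filter_forall => /= i.
exact: ((cvgrPdist_le _ _).1 (cM i.1 i.2)).
Unshelve. all: by end_near. Qed.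

Lemma differentiable_mx m n (M : V -> 'M[R]_(m, n)) x :
  (forall i j, differentiable (fun z => M z i j) x) -> differentiable M x.
Proof.
move=> dM.
have -> : M = \sum_i \sum_j (fun z => M z i j *: delta_mx i j).
  apply/funext => z; rewrite [LHS]matrix_sum_delta.
  rewrite fct_sumE; apply: eq_bigr => i _; rewrite fct_sumE.
  by apply: eq_bigr => j _.
apply: differentiable_sum => i; apply: differentiable_sum => j.
exact: differentiableZl.
Qed.

(** Entrywise, so that products, blocks, determinants and inverses reduce to the scalar lemmas. *)
Definition C1_mx m n (x : V) (M : V -> 'M[R]_(m, n)) : Prop :=
  forall i j, C1_near x (fun z => M z i j).

Lemma C1_mx_differentiable m n x (M : V -> 'M[R]_(m, n)) :
  C1_mx x M -> differentiable M x.
Proof.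
by move=> cM; apply: differentiable_mx => i j; exact: C1_near_differentiable.
Qed.

Lemma C1_mx_derive m n x (M : V -> 'M[R]_(m, n)) v i j : C1_mx x M ->
  ('D_v M x) i j = 'D_v (fun z => M z i j) x.
Proof.
move=> cM; rewrite derive_mx ?mxE //.
exact/diff_derivable/C1_mx_differentiable.
Qed.

Lemma C1_mx_near m n x (M : V -> 'M[R]_(m, n)) :
  C1_mx x M -> \forall y \near x, C1_mx y M.
Proof.
move=> cM.
apply: filter_forall => i; apply: filter_forall => j; exact: C1_near_near.
Qed.

Lemma C1_mx_eq m n x (M P : V -> 'M[R]_(m, n)) :
  (\forall y \near x, M y = P y) -> C1_mx x M -> C1_mx x P.
Proof.
move=> MP cM i j; apply: C1_near_eq (cM i j).
by apply: filterS MP => y ->.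
Qed.

Lemma Ck1_C1_mx m n (D : set V) (M : V -> 'M[R]_(m, n)) x :
  open D -> D x -> Ck 1 D M -> C1_mx x M.
Proof.
move=> oD Dx [dM cM] i j.
have nD : \forall y \near x, D y by exact: open_nbhs_nbhs.
move/near_join: nD; apply: filterS => y nD.
have Dy := nbhs_singleton nD.
split=> [|v].
  apply: (@differentiable_comp _ _ _ _ M (fun N : 'M[R]_(m, n) => N i j)).
    exact: dM.
  exact: differentiable_coord.
apply: (@near_eq_continuous_for _ _ (fun z => ('D_v M z) i j)).
  apply: filterS nD => z Dz; rewrite derive_mx ?mxE //.
  exact/diff_derivable/dM.
apply: (@continuous_comp _ _ _ ('D_v M) (fun N : 'M[R]_(m, n) => N i j)).
  exact: cM.
exact: coord_continuous.
Qed.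

Lemma C1_mx_Ck1 m n (M : V -> 'M[R]_(m, n)) x :
  C1_mx x M -> \forall y \near x, differentiable M y /\
    forall v, {for y, continuous ('D_v M)}.
Proof.
move=> /C1_mx_near /near_join; apply: filterS => y cM.
have cMy := nbhs_singleton cM.
split=> [|v]; first exact: C1_mx_differentiable.
apply: continuous_mx => i j.
apply: (@near_eq_continuous_for _ _ ('D_v (fun z => M z i j))).
  by apply: filterS cM => z cMz; rewrite C1_mx_derive.
by have [_] := nbhs_singleton (cMy i j).
Qed.

(** Turns germs back into [Ck 1] on one open set, the form in which [local_orthonormal_frame] asks
    for them. A common neighbourhood exists because the family is finite. *)
Lemma C1_mx_family_Ck1 k m n (M : 'I_k -> V -> 'M[R]_(m, n)) x :
  (forall i, C1_mx x (M i)) -> exists U : set V, open_nbhs x U /\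
    forall i, Ck 1 U (M i).
Proof.
move=> cM.
have : \forall y \near x, forall i, differentiable (M i) y /\
    forall v, {for y, continuous ('D_v (M i))}.
  by apply: filter_forall => i; exact: C1_mx_Ck1.
rewrite -[X in X -> _]/(nbhs x _) nbhsE => -[U oU sU]; exists U; split=> // i.
by split=> [z Uz|v z Uz]; have [] := sU _ Uz i.
Qed.

Lemma C1_mx_cst m n x (M : 'M[R]_(m, n)) : C1_mx x (fun=> M).
Proof. by move=> i j; exact: C1_near_cst. Qed.

Lemma C1_mxM m n p x (M : V -> 'M[R]_(m, n)) (P : V -> 'M[R]_(n, p)) :
  C1_mx x M -> C1_mx x P -> C1_mx x (fun z => M z *m P z).
Proof.
move=> cM cP i j; apply: C1_near_eq (C1_near_sum _ _ _); last first.
  by move=> k; exact: C1_nearM (cM i k) (cP k j).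
by apply: nearW => y; rewrite mxE.
Qed.

Lemma C1_mxZ m n x (f : V -> R) (M : V -> 'M[R]_(m, n)) :
  C1_near x f -> C1_mx x M -> C1_mx x (fun z => f z *: M z).
Proof.
move=> cf cM i j; apply: C1_near_eq (C1_nearM cf (cM i j)).
by apply: nearW => y; rewrite mxE.
Qed.

Lemma C1_mxB m n x (M P : V -> 'M[R]_(m, n)) :
  C1_mx x M -> C1_mx x P -> C1_mx x (fun z => M z - P z).
Proof.
move=> cM cP i j; apply: C1_near_eq (C1_nearB (cM i j) (cP i j)).
by apply: nearW => y; rewrite !mxE.
Qed.

Lemma C1_mx_tr m n x (M : V -> 'M[R]_(m, n)) :
  C1_mx x M -> C1_mx x (fun z => (M z)^T).
Proof.
move=> cM i j; apply: C1_near_eq (cM j i).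
by apply: nearW => y; rewrite mxE.
Qed.

Lemma C1_mx_rowi m n x i (A : V -> 'M[R]_(m, n)) :
  C1_mx x A -> C1_mx x (fun z => row i (A z)).
Proof.
move=> cA k j; apply: C1_near_eq (cA i j).
by apply: nearW => y; rewrite mxE.
Qed.

Lemma C1_mx_row m n1 n2 x (A : V -> 'M[R]_(m, n1)) (B : V -> 'M[R]_(m, n2)) :
  C1_mx x A -> C1_mx x B -> C1_mx x (fun z => row_mx (A z) (B z)).
Proof.
move=> cA cB i j; case: (split_ordP j) => k ->.
  by apply: C1_near_eq (cA i k); apply: nearW => y; rewrite row_mxEl.
by apply: C1_near_eq (cB i k); apply: nearW => y; rewrite row_mxEr.
Qed.

Lemma C1_mx_col m1 m2 n x (A : V -> 'M[R]_(m1, n)) (B : V -> 'M[R]_(m2, n)) :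
  C1_mx x A -> C1_mx x B -> C1_mx x (fun z => col_mx (A z) (B z)).
Proof.
move=> cA cB i j; case: (split_ordP i) => k ->.
  by apply: C1_near_eq (cA k j); apply: nearW => y; rewrite col_mxEu.
by apply: C1_near_eq (cB k j); apply: nearW => y; rewrite col_mxEd.
Qed.

Lemma C1_mx_block m1 m2 n1 n2 x (A : V -> 'M[R]_(m1, n1))
    (B : V -> 'M[R]_(m1, n2)) (C : V -> 'M[R]_(m2, n1))
    (D : V -> 'M[R]_(m2, n2)) :
  C1_mx x A -> C1_mx x B -> C1_mx x C -> C1_mx x D ->
  C1_mx x (fun z => block_mx (A z) (B z) (C z) (D z)).
Proof. by move=> *; apply: C1_mx_col; exact: C1_mx_row. Qed.

Lemma C1_mx_scalar n x (f : V -> R) :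
  C1_near x f -> C1_mx x (fun z => (f z)%:M : 'M[R]_n).
Proof.
move=> cf i j; apply: C1_near_eq (C1_nearM cf (C1_near_cst x (i == j)%:R)).
by apply: nearW => y; rewrite mxE mulr_natr.
Qed.

Lemma C1_mx_det n x (M : V -> 'M[R]_n) :
  C1_mx x M -> C1_near x (fun z => \det (M z)).
Proof.
move=> cM; apply: C1_near_sum => s.
apply: C1_nearM; first exact: C1_near_cst.
by apply: C1_near_prod => i.
Qed.

(** Cramer's formula. It describes [invmx] only where the determinant is non-zero, which by
    continuity is a neighbourhood of [x]. *)
Lemma C1_mx_inv n x (M : V -> 'M[R]_n) :
  M x \in unitmx -> C1_mx x M -> C1_mx x (fun z => invmx (M z)).
Proof.
move=> uM cM.
have cdet := C1_mx_det cM.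
have det0 : \det (M x) != 0 by rewrite -unitfE -unitmxE.
apply: (@C1_mx_eq _ _ _ (fun z => (\det (M z))^-1 *: \adj (M z))).
  have : \forall y \near x, \det (M y) != 0.
    exact: (C1_near_continuous cdet
      (open_nbhs_nbhs (conj (@open_neq R 0) det0))).
  by apply: filterS => y y0; rewrite /invmx unitmxE unitfE y0.
apply: C1_mxZ => [|i j]; first exact: C1_nearV.
apply: (@C1_near_eq _ _ _ (fun z => cofactor (M z) j i)).
  by apply: nearW => y; rewrite mxE.
apply: C1_nearM; first exact: C1_near_cst.
apply: C1_mx_det => k l; apply: C1_near_eq (cM (lift j k) (lift i l)).
by apply: nearW => y; rewrite !mxE.
Qed.

Lemma derive_mulmx m n p x v (A : V -> 'M[R]_(m, n)) (B : V -> 'M[R]_(n, p)) :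
  C1_mx x A -> C1_mx x B ->
  'D_v (fun z => A z *m B z) x = 'D_v A x *m B x + A x *m 'D_v B x.
Proof.
move=> cA cB; apply/matrixP => i j.
rewrite (C1_mx_derive v i j (C1_mxM cA cB)) !mxE -big_split /=.
have -> : (fun z => (A z *m B z) i j) =
    \sum_k ((fun z => A z i k) * (fun z => B z k j)).
  by apply/funext => z; rewrite fct_sumE mxE.
rewrite derive_sum; last first.
  by move=> k; apply: derivableM; exact: C1_near_derivable.
apply: eq_bigr => k _; rewrite deriveM; last 2 first.
- exact: C1_near_derivable.
- exact: C1_near_derivable.
rewrite !C1_mx_derive // addrC; congr (_ + _); exact: mulrC.
Qed.

End C1Matrix.

(** * Orthonormal frames *)

Section Orthonormalization.
Variable R : realType.

(** Polarization: if all squares vanish, so does the bilinear form, and a zero matrix of positive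
    size is singular. *)
Lemma sym_unit_anisotropic n (h : 'M[R]_n.+1) :
  h^T = h -> h \in unitmx -> exists w : 'rV_n.+1, (w *m h *m w^T) 0 0 != 0.
Proof.
move=> hs hu; apply: contrapT => /forallNP iso.
have {}iso (w : 'rV_n.+1) : (w *m h *m w^T) 0 0 = 0.
  by apply/eqP/negPn/negP => w0; apply: (iso w).
have bil (w v : 'rV_n.+1) : (w *m h *m v^T) 0 0 = 0.
  have sw : (v *m h *m w^T) 0 0 = (w *m h *m v^T) 0 0.
    have -> : w *m h *m v^T = (v *m h *m w^T)^T.
      by rewrite !trmx_mul trmxK hs mulmxA.
    by rewrite [RHS]mxE.
  have := iso (w + v).
  rewrite linearD /= mulmxDr !mulmxDl.
  rewrite mxE [X in X + _]mxE [X in _ + X]mxE !iso add0r addr0 sw.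
  by move=> H; lra.
have h0 : h = 0.
  apply/matrixP => i j; rewrite [RHS]mxE -(bil (delta_mx 0 i) (delta_mx 0 j)).
  by rewrite trmx_delta -rowE -colE !mxE.
by move: hu; rewrite h0 unitmxE det0 unitr0.
Qed.

(** [row_ebase w] completes the line of an anisotropic [w] to a basis: [w] is a multiple of its row
    0, so this row is anisotropic too. *)
Lemma anisotropic_basis n (h : 'M[R]_n.+1) :
  h^T = h -> h \in unitmx ->
  exists Q : 'M[R]_n.+1, (Q *m h *m Q^T) 0 0 != 0 /\ Q \in unitmx.
Proof.
move=> hs hu; have [w w0] := sym_unit_anisotropic hs hu.
exists (row_ebase w); split; last exact: row_ebase_unit.
apply: contra_neq w0 => Q0.
have wE : w = (col_ebase w *m pid_mx (\rank w)) *m row_ebase w.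
  by rewrite mulmx_ebase.
set c := _ *m pid_mx _ in wE.
rewrite wE trmx_mul !mulmxA -(mulmxA c) -(mulmxA c) -(mulmxA _ _ c^T).
set A := row_ebase w *m h *m (row_ebase w)^T in Q0 *.
have cE : c = c 0 0 *: delta_mx 0 0.
  apply/rowP => j; rewrite !mxE eqxx /=.
  case: (eqVneq j 0) => [->|j0]; first by rewrite mulr1.
  rewrite mulr0 big1 // => k _; rewrite !mxE (ord1 k).
  by rewrite (_ : (_ == _) = false) ?mulr0 //; apply/negbTE; rewrite eq_sym.
rewrite cE linearZ /= -scalemxAl -!scalemxAr scalerA mxE trmx_delta.
by rewrite mulmxA -rowE -colE [X in _ * X]mxE [X in _ * X]mxE Q0 mulr0.
Qed.

Lemma sym_block_mx n (M : 'M[R]_(1 + n)) : M^T = M ->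
  M = block_mx (M 0 0)%:M (ursubmx M) (ursubmx M)^T (drsubmx M).
Proof.
move=> Ms; rewrite -[LHS]submxK trmx_ursub Ms; congr block_mx.
rewrite [LHS]mx11_scalar !mxE; congr (M _ _)%:M; exact/val_inj.
Qed.

(** One step of symmetric Gaussian elimination: [L] removes from the remaining basis vectors their
    component along the first, which leaves the Schur complement. *)
Lemma schur_congr n (a : R) (c : 'rV[R]_n) (d : 'M[R]_n)
    (L := block_mx (1%:M : 'M[R]_1) 0 (- a^-1 *: c^T) 1%:M) : a != 0 ->
  L *m block_mx a%:M c c^T d *m L^T =
  block_mx a%:M 0 0 (d - a^-1 *: (c^T *m c)).
Proof.
move=> a0; rewrite /L tr_block_mx !mulmx_block.
rewrite !(trmx1, trmx0, linearZ) /= trmxK.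
rewrite !(mulmx0, mul0mx, mul1mx, mulmx1, addr0, add0r).
rewrite mul_scalar_mx -scalemxAl mul_mx_scalar !scalerA mulNr mulVf //.
rewrite !scaleN1r addNr [- c^T + _]addNr mul0mx scaler0 add0r -scalemxAl.
by rewrite scalerN scaleNr addrC.
Qed.

Lemma scalar_diag_block n (a : R) (v : 'I_n -> R) :
  block_mx (a%:M : 'M[R]_1) 0 0 (diag_mx (\row_i v i)) =
  diag_mx (\row_i oapp v a (unlift 0 i) : 'rV_(1 + n)).
Proof.
have -> : (a%:M : 'M[R]_1) = diag_mx a%:M.
  by apply/matrixP => i j; rewrite !ord1 !mxE.
rewrite -diag_mx_row; congr diag_mx; apply/rowP => i; rewrite [RHS]mxE.
case: (@split_ordP 1 n i) => k ->.
  by rewrite row_mxEl (ord1 k) lshift0 unlift_none mxE eqxx.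
by rewrite row_mxEr rshift1 liftK mxE.
Qed.

(* Gram-Schmidt for an indefinite form: split off a vector anisotropic at [x]
   (constant change of basis [Q]) and recurse on the Schur complement. *)
Lemma orthonormalization (V : normedModType R) (x : V) n (h : V -> 'M[R]_n) :
  C1_mx x h -> (\forall y \near x, (h y)^T = h y) -> h x \in unitmx ->
  exists (P : V -> 'M[R]_n) (eps : 'I_n -> R),
    [/\ forall i, eps i = 1 \/ eps i = -1, C1_mx x P &
      \forall y \near x, P y *m h y *m (P y)^T = diag_mx (\row_i eps i)].
Proof.
elim: n h => [|n IH] h ch hs hu.
  exists (fun=> 0), (fun=> 1); split; [by case|exact: C1_mx_cst|].
  by apply: nearW => y; apply/matrixP => -[].
have [Q [Q0 Qu]] := anisotropic_basis (nbhs_singleton hs) hu.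
pose h1 := (fun y => Q *m h y *m Q^T) : V -> 'M[R]_(1 + n).
have ch1 : C1_mx x h1.
  exact: (C1_mxM (C1_mxM (C1_mx_cst x Q) ch) (C1_mx_cst x Q^T)).
have h1s : \forall y \near x, (h1 y)^T = h1 y.
  by apply: filterS hs => y hs; rewrite /h1 !trmx_mul trmxK hs mulmxA.
pose a y := h1 y 0 0.
pose c y := ursubmx (h1 y).
pose d y := drsubmx (h1 y).
have h1E : \forall y \near x, h1 y = block_mx (a y)%:M (c y) (c y)^T (d y).
  by apply: filterS h1s => y; exact: sym_block_mx.
pose h' y := d y - (a y)^-1 *: ((c y)^T *m c y).
have ca : C1_near x a by exact: ch1.
have cc : C1_mx x c.
  move=> i j; apply: C1_near_eq (ch1 (lshift n i) (rshift 1 j)).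
  by apply: nearW => y; rewrite !mxE.
have cd : C1_mx x d.
  move=> i j; apply: C1_near_eq (ch1 (rshift 1 i) (rshift 1 j)).
  by apply: nearW => y; rewrite !mxE.
have a0 : a x != 0 by exact: Q0.
have ch' : C1_mx x h'.
  exact: (C1_mxB cd (C1_mxZ (C1_nearV a0 ca) (C1_mxM (C1_mx_tr cc) cc))).
have h's : \forall y \near x, (h' y)^T = h' y.
  apply: filterS h1s => y h1s.
  rewrite /h' linearB linearZ /= trmx_mul trmxK; congr (_ - _).
  by rewrite /d trmx_drsub h1s.
pose L y := block_mx (1%:M : 'M[R]_1) 0 (- (a y)^-1 *: (c y)^T) 1%:M.
have LE : \forall y \near x,
    L y *m h1 y *m (L y)^T = block_mx (a y)%:M 0 0 (h' y).
  have ane0 : \forall y \near x, a y != 0.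
    exact: (C1_near_continuous ca (open_nbhs_nbhs (conj (@open_neq R 0) a0))).
  apply: filterS2 ane0 h1E => y ay ->.
  exact: schur_congr.
(* Invertibility passes to the Schur complement through the determinant of the congruent block
   matrix. *)
have uh' : h' x \in unitmx.
  have LEx := nbhs_singleton LE.
  have uL : L x \in unitmx by rewrite unitmxE det_lblock !det1 mulr1 unitr1.
  have : L x *m h1 x *m (L x)^T \in unitmx.
    rewrite unitmx_mul unitmx_tr uL andbT unitmx_mul uL.
    by rewrite /h1 !unitmx_mul unitmx_tr Qu hu.
  by rewrite LEx unitmxE det_ublock unitrM => /andP[_]; rewrite -unitmxE.
have [P [eps [epsE cP PE]]] := IH h' ch' h's uh'.
pose s y := (Num.sqrt `|a y|)^-1.
(* The sign of [a] is constant near [x], so there the absolute value of [a y] is the C^1 function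
   [Num.sg (a x) * a y]. *)
have csa : C1_near x (fun y => Num.sg (a x) * a y).
  exact: C1_nearM (C1_near_cst _ _) ca.
have sa0 : 0 < Num.sg (a x) * a x by rewrite -normrEsg normr_gt0.
have sa : \forall y \near x, 0 < Num.sg (a x) * a y.
  exact: (C1_near_continuous csa (open_nbhs_nbhs (conj (@open_gt R 0) sa0))).
(* Composite change of basis: [Q], elimination by [L], then normalisation of the first vector by [s]
   and the recursive [P] on the others. *)
exists (fun y => block_mx (s y)%:M 0 0 (P y) *m L y *m Q).
exists (fun i => oapp eps (Num.sg (a x)) (unlift 0 i)).
split.
- move=> i; case: unliftP => [j|] _ /=; first exact: epsE.
  have [a1|a1|a1] := ltgtP (a x) 0.
  - by right; exact: ltr0_sg.
  - by left; exact: gtr0_sg.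
  by rewrite a1 eqxx in a0.
- have cs : C1_near x s.
    apply: (@C1_near_eq _ _ _ (fun y => (Num.sqrt (Num.sg (a x) * a y))^-1)).
      apply: filterS sa => y /gtr0_norm; rewrite normrM normr_sg a0 mul1r.
      by rewrite /s => ->.
    by apply: C1_nearV; [rewrite gt_eqF ?sqrtr_gt0|exact: C1_near_sqrt].
  apply: C1_mxM; last exact: C1_mx_cst.
  apply: C1_mxM.
    exact: (@C1_mx_block _ _ 1 n 1 n _ _ _ _ _ (C1_mx_scalar cs)
      (C1_mx_cst _ _) (C1_mx_cst _ _) cP).
  have cLdl := C1_mxZ (C1_nearN (C1_nearV a0 ca)) (C1_mx_tr cc).
  exact: (@C1_mx_block _ _ 1 n 1 n _ _ _ _ _ (C1_mx_cst _ _)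
    (C1_mx_cst _ _) cLdl (C1_mx_cst _ _)).
apply: filterS3 LE PE sa => y LE PE say.
have -> : block_mx (s y)%:M 0 0 (P y) *m L y *m Q *m h y *m
    (block_mx (s y)%:M 0 0 (P y) *m L y *m Q)^T =
    block_mx (s y)%:M 0 0 (P y) *m (L y *m h1 y *m (L y)^T) *m
    (block_mx (s y)%:M 0 0 (P y))^T.
  by rewrite /h1 !trmx_mul !mulmxA.
rewrite LE tr_block_mx !mulmx_block.
rewrite !(mulmx0, mul0mx, addr0, add0r, trmx0) PE tr_scalar_mx.
rewrite -!scalar_mxM.
have -> : s y * a y * s y = Num.sg (a x).
  have aE : a y = Num.sg (a x) * `|a y|.
    have -> : `|a y| = Num.sg (a x) * a y.
      by rewrite -(gtr0_norm say) normrM normr_sg a0 mul1r.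
    by rewrite mulrA -expr2 sqr_sg a0 mul1r.
  have n0 : 0 < `|a y|.
    by rewrite normr_gt0; apply: contraTneq say => ->; rewrite mulr0 ltxx.
  rewrite mulrAC -expr2 [X in _ * X]aE mulrCA /s exprVn sqr_sqrtr ?normr_ge0 //.
  by rewrite mulVf ?mulr1 // gt_eqF.
exact: scalar_diag_block.
Qed.

End Orthonormalization.

(** * Graphs in the warped product *)

Section GraphAlgebra.
Variables (R : realType) (n : nat) (g : 'M[R]_n) (p : 'rV[R]_n) (b : R).
Hypotheses (gs : g^T = g) (gu : g \in unitmx) (b0 : b != 0).

(* With [p] the components of df: [V] is the gradient of f, [omega] is df - dt,
   [N] is its metric dual, normal to the graph, and [q] is <N, N>. *)
Let V := p *m invmx g.
Let G : 'M[R]_(n + 1) := block_mx (b ^+ 2 *: g) 0 0 (-1)%:M.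
Let J : 'M[R]_(n, n + 1) := row_mx 1%:M p^T.
Let h := b ^+ 2 *: g - p^T *m p.
Let N : 'rV[R]_(n + 1) := row_mx (b ^- 2 *: V) 1%:M.
Let omega : 'cV[R]_(n + 1) := col_mx p^T (-1)%:M.
Let q := (V *m p^T) 0 0 / b ^+ 2 - 1.

Lemma invmx_sym : (invmx g)^T = invmx g.
Proof. by rewrite trmx_inv gs. Qed.

Lemma dual_mul_metric : V *m g = p.
Proof. by rewrite /V mulmxKV. Qed.

Lemma metric_mul_dual : g *m V^T = p^T.
Proof. by rewrite -{1}gs -trmx_mul dual_mul_metric. Qed.

Lemma graph_pullbackE : J *m G *m J^T = h.
Proof.
rewrite /J /G tr_row_mx mul_row_block mul_row_col trmx1 trmxK mul1mx.
by rewrite !mulmx0 addr0 add0r mulmx1 mul_mx_scalar scaleN1r mulNmx.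
Qed.

Lemma warped_mul_normal : G *m N^T = omega.
Proof.
rewrite /G /N tr_row_mx mul_block_col !mul0mx addr0 add0r trmx1 mulmx1.
rewrite linearZ /= -scalemxAl -scalemxAr scalerA mulfV ?expf_neq0 // scale1r.
by rewrite metric_mul_dual.
Qed.

Lemma normal_mul_omega : (N *m omega) 0 0 = q.
Proof.
rewrite /N /omega mul_row_col mul1mx -scalemxAl.
by rewrite mxE [X in X + _]mxE [X in _ + X]mxE eqxx mulr1n mulrC.
Qed.

(** If [q = 0], then [V] is a null vector of [h], hence zero; but [V = 0] forces [q = -1]. *)
Lemma normal_norm_neq0 : h \in unitmx -> q != 0.
Proof.
move=> hu; apply/eqP => q0.
have Vp : (V *m p^T) = (b ^+ 2)%:M.
  rewrite [LHS]mx11_scalar; congr _%:M.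
  apply: (@divIf _ (b ^+ 2)); rewrite ?expf_neq0 // divff ?expf_neq0 //.
  exact/subr0_eq.
have Vh : V *m h = 0.
  rewrite /h mulmxBr mulmxA Vp mul_scalar_mx -scalemxAr dual_mul_metric.
  by rewrite subrr.
have V0 : V = 0 by rewrite -[V](mulmxK hu) Vh mul0mx.
move/matrixP: Vp => /(_ 0 0); rewrite V0 mul0mx !mxE eqxx mulr1n => /esym/eqP.
by rewrite expf_eq0 /= (negbTE b0).
Qed.

(** [w] is [alpha *: N] plus a vector killed by [omega], that is, a tangent one. Invertibility of
    [h] makes the kernel and the tangent space meet only in 0, so that [proj_mx] is a genuine
    projection. *)
Lemma normal_projE (w : 'rV[R]_(n + 1)) : h \in unitmx ->
  w *m proj_mx (kermx (G *m J^T)) <<J>>%MS = ((w *m omega) 0 0 / q) *: N.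
Proof.
move=> hu; have q0 := normal_norm_neq0 hu.
set alpha := _ / q.
have dis : (kermx (G *m J^T) :&: <<J>> = 0)%MS.
  apply/eqP; rewrite -submx0; apply/rV_subP => u.
  rewrite sub_capmx => /andP[/sub_kermxP uK].
  rewrite genmxE => /submxP[xi uE]; move: uK.
  rewrite uE -mulmxA (mulmxA J) graph_pullbackE.
  move=> /(congr1 (mulmx^~ (invmx h))).
  by rewrite mulmxK // mul0mx => ->; rewrite mul0mx sub0mx.
have NK : (N <= kermx (G *m J^T))%MS.
  apply/sub_kermxP; rewrite mulmxA.
  have -> : N *m G = omega^T.
    rewrite -warped_mul_normal trmx_mul trmxK /G tr_block_mx !trmx0.
    by rewrite tr_scalar_mx linearZ /= gs.
  rewrite /omega /J tr_col_mx tr_row_mx mul_row_col trmxK trmx1 mulmx1.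
  by rewrite tr_scalar_mx mul_scalar_mx scaleN1r subrr.
have wJ : (w - alpha *: N <= <<J>>)%MS.
  rewrite genmxE; apply/submxP; exists (lsubmx (w - alpha *: N)).
  set w' := w - _.
  have : w' *m omega = 0.
    rewrite [LHS]mx11_scalar /w' mulmxBl -scalemxAl.
    rewrite [X in X%:M]mxE [X in _ + X]mxE [X in _ - X]mxE normal_mul_omega.
    by rewrite divfK // subrr raddf0.
  rewrite -{1}[w']hsubmxK /omega mul_row_col mul_mx_scalar scaleN1r.
  move/subr0_eq => w'E.
  by rewrite -{1}[w']hsubmxK /J mul_mx_row mulmx1 w'E.
rewrite -{1}[w](subrK (alpha *: N)) mulmxDl proj_mx_0 // add0r.
by rewrite proj_mx_id // scalemx_sub.
Qed.

(** Sherman-Morrison formula for a rank-one perturbation of [b ^+ 2 *: g]; its denominator 1 - |grad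
    f|^2 / b^2 is [- q]. *)
Lemma graph_pullback_inv : h \in unitmx ->
  invmx h = b ^- 2 *: (invmx g - (b ^+ 2 * q)^-1 *: (V^T *m V)).
Proof.
move=> hu; have q0 := normal_norm_neq0 hu.
apply: (can_inj (mulKmx hu)); rewrite mulmxV //.
have VpT : p *m V^T = (b ^+ 2 * (q + 1))%:M.
  have -> : p *m V^T = (V *m p^T)^T by rewrite (trmx_mul V) trmxK.
  rewrite [LHS]mx11_scalar; congr _%:M.
  by rewrite mxE /q subrK mulrC divfK ?expf_neq0.
rewrite -scalemxAr mulmxBr /h !mulmxBl -!scalemxAr -!scalemxAl mulmxV //.
rewrite (mulmxA g) metric_mul_dual -[p^T *m p *m invmx g]mulmxA -/V.
have -> : p^T *m p *m (V^T *m V) = (b ^+ 2 * (q + 1)) *: (p^T *m V).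
  by rewrite -mulmxA (mulmxA p) VpT mul_scalar_mx -scalemxAr.
apply/matrixP => i j; rewrite ![in RHS]mxE; move: (\sum_k _) => X.
rewrite mxE; move: (_%:R) => D; field.
by rewrite q0 b0.
Qed.

End GraphAlgebra.

(** A directional derivative sees the function along one line only. This carries partial derivatives
    of the warped metric over to derivatives on the base or on the real line, without asking for
    differentiability in all coordinates. *)
Lemma derive_line (R : realType) (V1 V2 W : normedModType R)
    (f1 : V1 -> W) (f2 : V2 -> W) (a1 v1 : V1) (a2 v2 : V2) :
  (forall t : R, f1 (t *: v1 + a1) = f2 (t *: v2 + a2)) ->
  'D_v1 f1 a1 = 'D_v2 f2 a2.
Proof.
move=> f12; rewrite /derive.
rewrite (_ : (fun t => t^-1 *: ((f1 \o shift a1) (t *: v1) - f1 a1)) =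
  (fun t => t^-1 *: ((f2 \o shift a2) (t *: v2) - f2 a2))) //.
apply/funext => t /=; rewrite f12.
by have := f12 0; rewrite !scale0r !add0r => ->.
Qed.

(** * Derivatives of matrix expressions; contraction of Christoffel symbols *)

Section Coordinates.
Variable R : realType.

Lemma rV_basis_sum n (v : 'rV[R]_n) : v = \sum_i v 0 i *: basis_vec R i.
Proof. exact: row_sum_delta. Qed.

Lemma derive_basis_sum n (W : normedModType R) (f : 'rV[R]_n -> W) z v :
  differentiable f z -> 'D_v f z = \sum_i v 0 i *: 'D_(basis_vec R i) f z.
Proof.
move=> df; rewrite deriveE // [in LHS](rV_basis_sum v) linear_sum.
by apply: eq_bigr => i _; rewrite linearZ deriveE.
Qed.

Lemma C1_mx_id m n (z : 'M[R]_(m, n)) : C1_mx z id.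
Proof.
move=> i j; apply: C1_nearT => y; split=> [|v].
  exact: differentiable_coord.
rewrite (_ : 'D_v _ = fun=> v i j); first exact: cst_continuous.
apply/funext => w; have := derive_id w v.
rewrite derive_mx; last exact: derivable_id.
by move=> /matrixP/(_ i j); rewrite mxE.
Qed.

Lemma derive_row_mx (V : normedModType R) m n1 n2 x v (A : V -> 'M[R]_(m, n1))
    (B : V -> 'M[R]_(m, n2)) :
  C1_mx x A -> C1_mx x B ->
  'D_v (fun z => row_mx (A z) (B z)) x = row_mx ('D_v A x) ('D_v B x).
Proof.
move=> cA cB; apply/matrixP => i j.
rewrite (C1_mx_derive v i j (C1_mx_row cA cB)).
case: (split_ordP j) => k ->.
  rewrite row_mxEl C1_mx_derive //; apply: near_eq_derive.
  by apply: nearW => z; rewrite row_mxEl.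
rewrite row_mxEr C1_mx_derive //; apply: near_eq_derive.
by apply: nearW => z; rewrite row_mxEr.
Qed.

Lemma derive_trmx (V : normedModType R) m n x v (A : V -> 'M[R]_(m, n)) :
  C1_mx x A -> 'D_v (fun z => (A z)^T) x = ('D_v A x)^T.
Proof.
move=> cA; apply/matrixP => i j.
rewrite (C1_mx_derive v i j (C1_mx_tr cA)) mxE C1_mx_derive //.
by apply: near_eq_derive; apply: nearW => z; rewrite mxE.
Qed.

Lemma derive_scalemx (V : normedModType R) m n x v (f : V -> R)
    (A : V -> 'M[R]_(m, n)) :
  C1_near x f -> C1_mx x A ->
  'D_v (fun z => f z *: A z) x = 'D_v f x *: A x + f x *: 'D_v A x.
Proof.
move=> cf cA; apply/matrixP => i j.
rewrite (C1_mx_derive v i j (C1_mxZ cf cA)) !mxE C1_mx_derive //.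
have -> : (fun z => (f z *: A z) i j) = (fun z => f z) * (fun z => A z i j).
  by apply/funext => z; rewrite mxE.
rewrite (deriveM (C1_near_derivable cf) (C1_near_derivable (cA i j))) addrC.
by congr (_ + _); exact: mulrC.
Qed.

Lemma derive_scalar_mx11 (V : normedModType R) x v (f : V -> R) :
  C1_near x f -> 'D_v (fun z => (f z)%:M : 'M[R]_1) x = ('D_v f x)%:M.
Proof.
move=> cf; apply/matrixP => i j.
rewrite (C1_mx_derive v i j (C1_mx_scalar (n := 1) cf)).
rewrite !ord1 [RHS]mxE eqxx; apply: near_eq_derive.
by apply: nearW => z; rewrite mxE eqxx.
Qed.

(** Entrywise, as in [christoffel], so that the two can be matched for any [G], whether or not it is
    differentiable as a matrix-valued map. *)
Definition metric_derivative m (G : 'rV[R]_m -> 'M[R]_m) (z : 'rV[R]_m)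
    (e : 'I_m) : 'M[R]_m :=
  \matrix_(i, j) 'D_(basis_vec R e) (fun w => G w i j) z.

Lemma bilinear_sumE m (A B C : 'rV[R]_m) (M : 'I_m -> 'M[R]_m) :
  (B *m (\sum_e A 0 e *: M e) *m C^T) 0 0 =
  \sum_e \sum_d \sum_c A 0 e * B 0 d * M e d c * C 0 c.
Proof.
rewrite mulmx_sumr mulmx_suml summxE; apply: eq_bigr => e _.
rewrite -scalemxAr -scalemxAl mxE mxE mulr_sumr exchange_big /=.
apply: eq_bigr => c _; rewrite !mxE mulr_suml mulr_sumr.
by apply: eq_bigr => d _; rewrite -!mulrA.
Qed.

(** Koszul formula: pairing with [omega], the dual of [N], cancels the inverse metric inside
    [christoffel] and leaves derivatives of [G] only. *)
Lemma christoffel_contract m (G : 'rV[R]_m -> 'M[R]_m) (z : 'rV[R]_m)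
    (N v w : 'rV[R]_m) (omega : 'cV[R]_m)
    (D := fun a : 'rV_m => \sum_e a 0 e *: metric_derivative G z e) :
  G z \in unitmx -> (G z)^T = G z -> G z *m N^T = omega ->
  ((\row_a \sum_b \sum_c christoffel G z a b c * v 0 b * w 0 c) *m omega) 0 0 =
  2^-1 * ((N *m D v *m w^T) 0 0 + (N *m D w *m v^T) 0 0
          - (v *m D N *m w^T) 0 0).
Proof.
move=> Gu Gs GN.
have NE d : N 0 d = \sum_a omega a 0 * invmx (G z) a d.
  have -> : N = omega^T *m invmx (G z).
    by rewrite -GN trmx_mul trmxK Gs mulmxK.
  by rewrite mxE; apply: eq_bigr => a _; rewrite mxE.
rewrite /D !bilinear_sumE.
pose dG e i j := metric_derivative G z e i j.
have dGE e i j : metric_derivative G z e i j = dG e i j by [].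
(* Common form of both sides: one triple sum, whose three derivative terms are matched by exchanging
   summations. *)
transitivity (\sum_b \sum_c \sum_d
    2^-1 * N 0 d * (dG b d c + dG c d b - dG d b c) * v 0 b * w 0 c).
  rewrite mxE; under eq_bigr => a _ do rewrite mxE mulr_suml.
  rewrite exchange_big; apply: eq_bigr => b _ /=.
  under eq_bigr => a _ do rewrite mulr_suml.
  rewrite exchange_big; apply: eq_bigr => c _ /=.
  under eq_bigr => a _ do rewrite /christoffel mulr_sumr !mulr_suml.
  rewrite exchange_big; apply: eq_bigr => d _ /=.
  rewrite NE mulr_sumr !mulr_suml; apply: eq_bigr => a _.
  by rewrite /dG !mxE; ring.
rewrite mulrBr mulrDr !mulr_sumr.
have -> : \sum_i 2^-1 *
    (\sum_d \sum_c v 0 i * N 0 d * metric_derivative G z i d c * w 0 c) =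
    \sum_b \sum_c \sum_d 2^-1 * N 0 d * dG b d c * v 0 b * w 0 c.
  apply: eq_bigr => b _; rewrite exchange_big mulr_sumr; apply: eq_bigr => c _.
  by rewrite mulr_sumr; apply: eq_bigr => d _; rewrite dGE; ring.
have -> : \sum_i 2^-1 *
    (\sum_d \sum_c w 0 i * N 0 d * metric_derivative G z i d c * v 0 c) =
    \sum_b \sum_c \sum_d 2^-1 * N 0 d * dG c d b * v 0 b * w 0 c.
  rewrite [RHS]exchange_big; apply: eq_bigr => b _ /=.
  rewrite exchange_big mulr_sumr; apply: eq_bigr => c _.
  by rewrite mulr_sumr; apply: eq_bigr => d _; rewrite dGE; ring.
have -> : \sum_i 2^-1 *
    (\sum_d \sum_c N 0 i * v 0 d * metric_derivative G z i d c * w 0 c) =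
    \sum_b \sum_c \sum_d 2^-1 * N 0 d * dG d b c * v 0 b * w 0 c.
  under eq_bigr => d _ do rewrite mulr_sumr.
  rewrite exchange_big; apply: eq_bigr => b _ /=.
  under eq_bigr => d _ do rewrite mulr_sumr.
  rewrite exchange_big; apply: eq_bigr => c _ /=.
  by apply: eq_bigr => d _; rewrite dGE; ring.
rewrite -big_split -sumrB; apply: eq_bigr => b _ /=.
rewrite -big_split -sumrB; apply: eq_bigr => c _ /=.
rewrite -big_split -sumrB; apply: eq_bigr => d _ /=.
ring.
Qed.

End Coordinates.

Lemma derive_eq_cst (R : realType) (V W : normedModType R) (f : V -> W) (c : W)
    x v : (forall w, f w = c) -> 'D_v f x = 0.
Proof. by move=> fc; rewrite (_ : f = cst c) ?derive_cst //; exact/funext. Qed.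

(** * The warped metric and a graph in one product chart *)

Section WarpedChart.
Variables (R : realType) (n : nat) (g : 'rV[R]_n -> 'M[R]_n) (b : R -> R)
  (f : 'rV[R]_n -> R).

(** [warped] and [graph_map] are convertible to [warped_metric] and [graph] at [g := metric phi] and
    [f := u \o cinv phi], so results on them apply to the manifold as they stand. *)
Definition warped (z : 'rV[R]_(n + 1)) : 'M[R]_(n + 1) :=
  block_mx ((b (rsubmx z 0 0)) ^+ 2 *: g (lsubmx z)) 0 0 (-1)%:M.

Definition graph_map (z : 'rV[R]_n) : 'rV[R]_(n + 1) := row_mx z (f z)%:M.

Definition differential (z : 'rV[R]_n) : 'rV[R]_n :=
  \row_i 'D_(basis_vec R i) f z.

Lemma derive_differential z v : differentiable f z ->
  'D_v f z = (v *m (differential z)^T) 0 0.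
Proof.
move=> df; rewrite derive_basis_sum // mxE; apply: eq_bigr => i _.
by rewrite !mxE.
Qed.

Lemma C1_mx_graph_map z : C1_near z f -> C1_mx z graph_map.
Proof.
by move=> cf; apply: C1_mx_row; [exact: C1_mx_id|exact: C1_mx_scalar].
Qed.

Lemma derive_graph_map z v : C1_near z f ->
  'D_v graph_map z = row_mx v (v *m (differential z)^T).
Proof.
move=> cf; have df := C1_near_differentiable cf.
rewrite /graph_map (derive_row_mx v (C1_mx_id z) (C1_mx_scalar (n := 1) cf)).
rewrite derive_id (derive_scalar_mx11 v cf) (derive_differential v df).
by rewrite -mx11_scalar.
Qed.

Lemma jacobian_graph_map z : C1_near z f ->
  'J graph_map z = row_mx 1%:M (differential z)^T.
Proof.
move=> cf; apply/row_matrixP => i.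
have dF := C1_mx_differentiable (C1_mx_graph_map cf).
rewrite rowE -(deriveEjacobian (basis_vec R i) dF) (derive_graph_map _ cf).
by rewrite rowE mul_mx_row mulmx1.
Qed.

Lemma warped_graph z : warped (graph_map z) =
  block_mx (b (f z) ^+ 2 *: g z) 0 0 (-1)%:M.
Proof. by rewrite /warped /graph_map row_mxKr row_mxKl mxE eqxx. Qed.

Lemma warped_derivative_space z (k : 'I_n) : C1_mx z g ->
  metric_derivative warped (graph_map z) (lshift 1 k) =
  block_mx (b (f z) ^+ 2 *: 'D_(basis_vec R k) g z) 0 0 0.
Proof.
move=> cg; apply/matrixP => i j; rewrite mxE.
have line (t : R) : t *: basis_vec R (lshift 1 k) + graph_map z =
    row_mx (t *: basis_vec R k + z) (f z)%:M :> 'rV_(n + 1).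
  have -> : basis_vec R (lshift 1 k) = row_mx (basis_vec R k) 0 :> 'rV_(n + 1).
    apply/rowP => l; rewrite mxE.
    case: (split_ordP l) => m ->.
      by rewrite row_mxEl mxE (inj_eq (@lshift_inj _ _)).
    by rewrite row_mxEr mxE eq_rlshift andbF.
  by rewrite scale_row_mx scaler0 add_row_mx add0r.
case: (split_ordP i) => i' ->; case: (split_ordP j) => j' ->.
- rewrite block_mxEul mxE C1_mx_derive //.
  rewrite -[RHS](deriveZ (f := fun w => g w i' j')); last first.
    exact: C1_near_derivable.
  apply: derive_line => t; rewrite line /warped block_mxEul.
  by rewrite row_mxKr row_mxKl !mxE eqxx.
- rewrite block_mxEur mxE.
  by apply: (@derive_eq_cst _ _ _ _ 0) => w; rewrite /warped block_mxEur mxE.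
- rewrite block_mxEdl mxE.
  by apply: (@derive_eq_cst _ _ _ _ 0) => w; rewrite /warped block_mxEdl mxE.
- rewrite block_mxEdr mxE.
  by apply: (@derive_eq_cst R _ _ _ (((-1)%:M : 'M[R]_1) i' j')) => w;
    rewrite /warped block_mxEdr.
Qed.

Lemma warped_derivative_time z : C1_near (f z) b ->
  metric_derivative warped (graph_map z) (rshift n 0) =
  block_mx ((2 * b (f z) * 'D_1 b (f z)) *: g z) 0 0 0.
Proof.
move=> cb; apply/matrixP => i j; rewrite mxE.
have line (t : R) : t *: basis_vec R (rshift n 0) + graph_map z =
    row_mx z (t *: 1 + f z)%:M :> 'rV_(n + 1).
  have -> : basis_vec R (rshift n 0) = row_mx 0 1%:M :> 'rV_(n + 1).
    apply/rowP => l; rewrite mxE.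
    case: (split_ordP l) => m ->.
      by rewrite row_mxEl mxE eq_lrshift andbF.
    by rewrite row_mxEr (ord1 m) mxE !eqxx.
  rewrite scale_row_mx scaler0 add_row_mx add0r; congr row_mx.
  by rewrite [in RHS]raddfD /= scale_scalar_mx.
case: (split_ordP i) => i' ->; case: (split_ordP j) => j' ->.
- rewrite block_mxEul mxE.
  transitivity ('D_1 (fun s => (b s * b s) * g z i' j') (f z)).
    apply: derive_line => t; rewrite line /warped block_mxEul.
    by rewrite row_mxKr row_mxKl !mxE eqxx expr2.
  have db : derivable b (f z) 1 by exact: C1_near_derivable.
  have dbb : derivable (fun s => b s * b s) (f z) 1 by exact: derivableM.
  have -> : (fun s => b s * b s * g z i' j') =
      g z i' j' \*: (fun s => b s * b s).
    by apply/funext => s /=; rewrite mulrC.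
  rewrite deriveZ //= [X in _ *: X](deriveM db db).
  rewrite -[LHS]/(_ * (_ * _ + _ * _)). ring.
- rewrite block_mxEur mxE.
  by apply: (@derive_eq_cst _ _ _ _ 0) => w; rewrite /warped block_mxEur mxE.
- rewrite block_mxEdl mxE.
  by apply: (@derive_eq_cst _ _ _ _ 0) => w; rewrite /warped block_mxEdl mxE.
- rewrite block_mxEdr mxE.
  by apply: (@derive_eq_cst R _ _ _ (((-1)%:M : 'M[R]_1) i' j')) => w;
    rewrite /warped block_mxEdr.
Qed.

End WarpedChart.

(** * Second fundamental form of a graph *)

Section GraphCurvature.
Variables (R : realType) (n : nat) (g : 'rV[R]_n -> 'M[R]_n) (b : R -> R)
  (f : 'rV[R]_n -> R) (y : 'rV[R]_n).
Hypotheses (cg : C1_mx y g) (gs : (g y)^T = g y) (gu : g y \in unitmx)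
  (cf : C1_near y f) (cp : C1_mx y (differential f))
  (cb : C1_near (f y) b) (b0 : b (f y) != 0).

Let p := differential f y.
Let V := p *m invmx (g y).
Let b1 := 'D_1 b (f y).
Let dg k := 'D_(basis_vec R k) g y.
Let Dg (a : 'rV[R]_n) := \sum_k a 0 k *: dg k.
Let F := graph_map f.
Let G := warped g b.
Let omega : 'cV[R]_(n + 1) := col_mx p^T (-1)%:M.
Let N : 'rV[R]_(n + 1) := row_mx (b (f y) ^- 2 *: V) 1%:M.

Definition coord_hessian : 'M[R]_n :=
  \matrix_(i < n) 'D_(basis_vec R i) (differential f) y.

(* The entry (i, j) is the sum of [christoffel g y k i j * 'D_k f y] over k,
   up to terms antisymmetric in i and j. *)
Definition christoffel_term : 'M[R]_n :=
  \matrix_(a < n) (V *m dg a) - 2^-1 *: Dg V.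

(** As a matrix this need not be symmetric. It is only read through its quadratic form and its trace
    against symmetric matrices, which ignore antisymmetric parts. *)
Definition covariant_hessian : 'M[R]_n := coord_hessian - christoffel_term.

Definition second_form : 'M[R]_n :=
  - covariant_hessian - (b (f y) * b1) *: g y
  + (2 * b1 / b (f y)) *: (p^T *m p).

Lemma addmx00 (A B : 'M[R]_1) : (A + B) 0 0 = A 0 0 + B 0 0.
Proof. exact: mxE. Qed.

Lemma oppmx00 (A : 'M[R]_1) : (- A) 0 0 = - A 0 0.
Proof. exact: mxE. Qed.

Lemma scalemx00 c (A : 'M[R]_1) : (c *: A) 0 0 = c * A 0 0.
Proof. exact: mxE. Qed.

Lemma trmx00 (A : 'M[R]_1) : A^T 0 0 = A 0 0.
Proof. exact: mxE. Qed.

Lemma matrix_mulmx_rows (a : 'rV[R]_n) m (r : 'I_n -> 'rV[R]_m) :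
  a *m (\matrix_i r i) = \sum_i a 0 i *: r i.
Proof.
apply/rowP => j; rewrite mxE summxE; apply: eq_bigr => i _; by rewrite !mxE.
Qed.

Lemma warped_derivative_dir (a : 'rV[R]_n) (s : R) :
  \sum_e (row_mx a s%:M : 'rV_(n + 1)) 0 e *: metric_derivative G (F y) e =
  block_mx (b (f y) ^+ 2 *: Dg a + (2 * b (f y) * b1 * s) *: g y) 0 0 0.
Proof.
rewrite big_split_ord big_ord1 /= row_mxEr mxE eqxx mulr1n.
rewrite warped_derivative_time // scale_block_mx !scaler0.
under eq_bigr => k _ do
  rewrite row_mxEl warped_derivative_space // scale_block_mx !scaler0.
have -> : \sum_i block_mx
      (a 0 i *: (b (f y) ^+ 2 *: 'D_(basis_vec R i) g y)) 0 0 0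
    = block_mx (b (f y) ^+ 2 *: Dg a) 0 0 0 :> 'M[R]_(n + 1).
  rewrite /Dg scaler_sumr.
  elim/big_ind2 : _ => [|A1 A2 B1 B2 -> ->|i _]; first by rewrite block_mx0.
    by rewrite add_block_mx !addr0.
  by rewrite !scalerA mulrC.
rewrite add_block_mx !addr0 scalerA; congr block_mx; congr (_ + _ *: _).
by rewrite mulrC.
Qed.

(** For equal arguments the contraction is N.(D_v G).v - v.(D_N G).v / 2. The time component
    [xi *m p^T] of [v] produces the term in [p^T *m p], and the time component 1 of [N] produces
    [- (b (f y) * b1) *: g y]. *)
Lemma warped_christoffel_normal (xi : 'rV[R]_n)
    (v : 'rV_(n + 1) := row_mx xi (xi *m p^T)) :
  ((\row_a \sum_c \sum_d christoffel G (F y) a c d * v 0 c * v 0 d)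
     *m omega) 0 0
  = (xi *m (christoffel_term - (b (f y) * b1) *: g y
      + (2 * b1 / b (f y)) *: (p^T *m p)) *m xi^T) 0 0.
Proof.
have GE : G (F y) = block_mx (b (f y) ^+ 2 *: g y) 0 0 (-1)%:M.
  exact: warped_graph.
rewrite (@christoffel_contract _ _ _ _ N).
- set s := (xi *m p^T) 0 0.
  have sE : xi *m p^T = s%:M by exact: mx11_scalar.
  rewrite /v sE /N warped_derivative_dir warped_derivative_dir.
  rewrite !mul_row_block !mulmx0 !addr0 tr_row_mx !mul_row_col !mul0mx !addr0.
  have VDg : xi *m (\matrix_(a < n) (V *m dg a)) = V *m Dg xi.
    rewrite matrix_mulmx_rows mulmx_sumr; apply: eq_bigr => a _.
    by rewrite -scalemxAr.
  have DgV : Dg (b (f y) ^- 2 *: V) = b (f y) ^- 2 *: Dg V.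
    rewrite /Dg scaler_sumr; apply: eq_bigr => k _.
    by rewrite mxE scalerA.
  rewrite DgV scalerA mulfV ?expf_neq0 // scale1r.
  rewrite /christoffel_term !mulmxDr !mulmxDl !mulmxN !mulNmx VDg.
  rewrite -!scalemxAr -!scalemxAl !addmx00 !oppmx00 !scalemx00.
  rewrite dual_mul_metric // mulmxA sE mul_scalar_mx -scalemxAl scalemx00.
  have -> : (p *m xi^T) 0 0 = s by rewrite -trmx00 trmx_mul trmxK.
  by field.
- rewrite GE unitmxE det_ublock unitrM -!unitmxE.
  by rewrite unitmxZ ?unitfE ?expf_neq0 // gu unitmxE det_scalar1 unitrN1.
- by rewrite GE tr_block_mx !trmx0 linearZ /= gs tr_scalar_mx.
- by rewrite GE warped_mul_normal.
Qed.

(** The derivative of [E] itself contributes a tangent vector, which [omega] kills; only the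
    derivative of the differential remains. *)
Lemma derive_tangent (E : 'rV[R]_n -> 'rV[R]_n) v : C1_mx y E ->
  'D_v (fun z => 'D_(E z) F z) y *m omega =
  - (E y *m ('D_v (differential f) y)^T).
Proof.
move=> cE.
have -> : 'D_v (fun z => 'D_(E z) F z) y =
    'D_v (fun z => row_mx (E z) (E z *m (differential f z)^T)) y.
  apply: near_eq_derive; apply: filterS (C1_near_near cf) => z cfz.
  exact: derive_graph_map.
have cpT := C1_mx_tr cp.
rewrite (derive_row_mx v cE (C1_mxM cE cpT)) (derive_mulmx v cE cpT).
rewrite (derive_trmx v cp).
rewrite /omega mul_row_col mul_mx_scalar scaleN1r opprD addrA subrr add0r.
by [].
Qed.

Lemma cov_along_normal (E : 'rV[R]_n -> 'rV[R]_n) : C1_mx y E ->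
  (cov_along G F (E y) (fun z => 'D_(E z) F z) y *m omega) 0 0 =
  (E y *m second_form *m (E y)^T) 0 0.
Proof.
move=> cE; rewrite /cov_along mulmxDl mxE derive_tangent //.
have -> : 'D_(E y) F y = row_mx (E y) (E y *m p^T) by exact: derive_graph_map.
rewrite warped_christoffel_normal /second_form /covariant_hessian.
have -> : 'D_(E y) (differential f) y = E y *m coord_hessian.
  rewrite derive_basis_sum; last exact: C1_mx_differentiable.
  by rewrite matrix_mulmx_rows.
(* A 1x1 matrix equals its transpose, which moves the Hessian from one copy of [E y] to the
   other. *)
have -> : (- (E y *m (E y *m coord_hessian)^T)) 0 0 =
    (E y *m (- coord_hessian) *m (E y)^T) 0 0.
  rewrite mulmxN mulNmx !mxE; congr (- _).
  rewrite (_ : \sum_j _ = (E y *m (E y *m coord_hessian)^T) 0 0).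
    rewrite (_ : E y *m (E y *m coord_hessian)^T =
                 (E y *m coord_hessian *m (E y)^T)^T); first by rewrite !mxE.
    by rewrite [RHS]trmx_mul trmxK.
  by rewrite [RHS]mxE.
rewrite -addmx00 -mulmxDl -mulmxDr.
congr ((_ *m _ *m _) 0 0); move: christoffel_term coord_hessian => T H.
by rewrite opprB !addrA (addrC (- H)).
Qed.

End GraphCurvature.

Lemma mulmx_row_entry (R : realType) m m' n n' (P : 'M[R]_(m, n))
    (S : 'M[R]_(n, n')) (Q : 'M[R]_(m', n')) i j :
  (P *m S *m Q^T) i j = (row i P *m S *m (row j Q)^T) 0 0.
Proof.
rewrite -row_mul mxE [RHS]mxE; apply: eq_bigr => k _.
by congr (_ * _); rewrite [RHS]mxE // [LHS]mxE [RHS]mxE.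
Qed.

(** The signs square to 1, so orthonormality of the rows of [P] inverts to h^-1 = P^T D P. The sum
    is therefore the same for all frames. *)
Lemma orthonormal_trace (R : realType) n (h S P : 'M[R]_n) (eps : 'I_n -> R) :
  h \in unitmx -> (forall i, eps i = 1 \/ eps i = -1) ->
  P *m h *m P^T = diag_mx (\row_i eps i) ->
  \sum_i eps i * (row i P *m S *m (row i P)^T) 0 0 = \tr (invmx h *m S).
Proof.
move=> hu epsE PhP; set D := diag_mx _ in PhP.
have DD : D *m D = 1%:M.
  rewrite /D mulmx_diag; apply/matrixP => i j; rewrite !mxE.
  by case: (epsE i) => ->; rewrite ?mulrNN mulr1.
have hP : h *m (P^T *m D *m P) = 1%:M.
  rewrite !mulmxA; apply: mulmx1C.
  by rewrite !mulmxA PhP.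
have -> : invmx h = P^T *m D *m P.
  by rewrite -[LHS]mulmx1 -hP mulKmx.
rewrite -!mulmxA mxtrace_mulC -!mulmxA /mxtrace; apply: eq_bigr => i _.
rewrite -mulmx_row_entry /D mul_diag_mx [RHS]mxE [X in _ = X * _]mxE.
by rewrite !mulmxA.
Qed.

(** * Mean curvature vector of a graph *)

Section GraphMeanCurvature.
Variables (R : realType) (n : nat) (g : 'rV[R]_n -> 'M[R]_n) (b : R -> R)
  (f : 'rV[R]_n -> R) (y : 'rV[R]_n).
Hypotheses (cg : C1_mx y g) (gs : \forall z \near y, (g z)^T = g z)
  (gu : g y \in unitmx)
  (cf : C1_near y f) (cp : C1_mx y (differential f))
  (cb : C1_near (f y) b) (b0 : b (f y) != 0).

Let p := differential f y.
Let V := p *m invmx (g y).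
Let F := graph_map f.
Let G := warped g b.
Let h z := b (f z) ^+ 2 *: g z - (differential f z)^T *m differential f z.
Let N : 'rV[R]_(n + 1) := row_mx (b (f y) ^- 2 *: V) 1%:M.
Let q := (V *m p^T) 0 0 / b (f y) ^+ 2 - 1.

Lemma graph_pullback z : C1_near z f -> pullback G F z = h z.
Proof.
move=> cfz; rewrite /pullback /G /F jacobian_graph_map // warped_graph.
exact: graph_pullbackE.
Qed.

Lemma gdot_graph z (v w : 'rV[R]_n) : C1_near z f ->
  gdot (G (F z)) ('D_v F z) ('D_w F z) = (v *m h z *m w^T) 0 0.
Proof.
move=> cfz; rewrite -graph_pullback // /pullback.
have dF := C1_mx_differentiable (C1_mx_graph_map cfz).
by rewrite /gdot !(deriveEjacobian _ dF) trmx_mul !mulmxA.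
Qed.

Lemma C1_mx_graph_pullback : C1_mx y h.
Proof.
apply: C1_mxB; last exact: C1_mxM (C1_mx_tr cp) cp.
apply: C1_mxZ cg; apply: (C1_near_comp cf (h := fun s => b s ^+ 2)).
exact: C1_nearM.
Qed.

Hypothesis hu : h y \in unitmx.

(** The rows of the orthonormalizing matrix of [h] form the frame. It witnesses the existential in
    [is_mean_curvature_vector]. *)
Lemma graph_frame : exists E eps, local_orthonormal_frame G F y E eps.
Proof.
have hs : \forall z \near y, (h z)^T = h z.
  apply: filterS gs => z gsz; rewrite /h linearB linearZ /= gsz.
  by rewrite trmx_mul trmxK.
have [P [eps [epsE cP PhP]]] := orthonormalization C1_mx_graph_pullback hs hu.
exists (fun i z => row i (P z)), eps; split=> //.
have cE i : C1_mx y (fun z => row i (P z)).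
  exact: C1_mx_rowi.
have [U [oU cU]] := C1_mx_family_Ck1 cE.
have := @filterI _ _ (nbhs_filter y) _ _ (C1_near_near cf) PhP.
rewrite -[X in X -> _]/(nbhs y _) nbhsE => -[U' oU' sU'].
exists (U `&` U'); split; first exact: open_nbhsI.
  move=> i; have [dU cdU] := cU i.
  by split=> [z [Uz _]|v z [Uz _]]; [exact: dU|exact: cdU].
move=> z [_ /sU'[cfz PhPz]] i j.
rewrite gdot_graph //; transitivity ((P z *m h z *m (P z)^T) i j).
  by apply/esym; exact: mulmx_row_entry.
by rewrite PhPz !mxE.
Qed.

Lemma frame_matrix E eps : local_orthonormal_frame G F y E eps ->
  (\matrix_i E i y) *m h y *m (\matrix_i E i y)^T = diag_mx (\row_i eps i).
Proof.
move=> [_ [U [[oU Uy] _ /(_ _ Uy) Eo]]]; apply/matrixP => i j.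
rewrite [RHS]mxE [X in X *+ _]mxE -Eo gdot_graph //.
by rewrite mulmx_row_entry !rowK.
Qed.

Lemma graph_normal_proj w :
  normal_proj G F y w = ((w *m col_mx p^T (-1)%:M) 0 0 / q) *: N.
Proof.
rewrite /normal_proj /G /F jacobian_graph_map // warped_graph.
by rewrite normal_projE //; exact: nbhs_singleton gs.
Qed.

(** The normal space is the line through [N], so the vector equation compares two coefficients. They
    can be read off in the last coordinate, where [N] is 1. The minus sign is the pairing of
    [dt_vec] with [omega]. *)
Lemma graph_mean_curvature c :
  is_mean_curvature_vector G F y (c *: normal_proj G F y (dt_vec R n)) <->
  - c = \tr (invmx (h y) *m second_form g b f y).
Proof.
have gsy := nbhs_singleton gs.
have q0 : q != 0 by exact: normal_norm_neq0 hu.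
have dtE : c *: normal_proj G F y (dt_vec R n) = (- c / q) *: N.
  rewrite graph_normal_proj /dt_vec mul_row_col mul0mx add0r mul1mx.
  by rewrite mxE eqxx scalerA mulrA mulrN1.
have HE E eps : local_orthonormal_frame G F y E eps ->
  \sum_i eps i *: normal_proj G F y
    (cov_along G F (E i y) (fun z => 'D_(E i z) F z) y) =
  (\tr (invmx (h y) *m second_form g b f y) / q) *: N.
  move=> Eo; have := frame_matrix Eo; case: Eo => epsE [U [[oU Uy] cE _]] EhE.
  rewrite -(orthonormal_trace _ hu epsE EhE) mulr_suml scaler_suml.
  apply: eq_bigr => i _; rewrite graph_normal_proj scalerA mulrA.
  have cEi : C1_mx y (E i) by exact: Ck1_C1_mx oU Uy (cE i).
  by rewrite (cov_along_normal cg gsy gu cf cp cb b0 cEi) rowK.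
split=> [[E [eps [Eo]]]|H].
  rewrite HE // dtE => /(congr1 (fun v => rsubmx v 0 0)).
  rewrite /N !scale_row_mx !row_mxKr !mxE eqxx !mulr1.
  by move=> /(divIf q0).
have [E [eps Eo]] := graph_frame; exists E, eps; split=> //.
by rewrite HE // dtE H.
Qed.

End GraphMeanCurvature.

(** * Divergence of the rescaled gradient *)

Section RealDerivatives.
Variables (R : realType) (V : normedModType R).
Implicit Types (f h : V -> R) (x v : V).

Lemma derive_mul x v f h : C1_near x f -> C1_near x h ->
  'D_v (fun z => f z * h z) x = 'D_v f x * h x + f x * 'D_v h x.
Proof.
move=> cf ch.
have := deriveM (C1_near_derivable (v := v) cf) (C1_near_derivable ch).
by rewrite addrC => ->; congr (_ + _); exact: mulrC.
Qed.

Lemma derive_inv x v f : f x != 0 -> C1_near x f ->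
  'D_v (fun z => (f z)^-1) x = - f x ^- 2 * 'D_v f x.
Proof. by move=> f0 cf; exact: deriveV f0 (C1_near_derivable cf). Qed.

Lemma derive_sqrt_comp x v f : 0 < f x -> C1_near x f ->
  'D_v (fun z => Num.sqrt (f z)) x = (2 * Num.sqrt (f x))^-1 * 'D_v f x.
Proof.
move=> f0 cf.
have [ds _] := is_derive1_sqrt f0; move/derivable1_diffP : ds => ds.
by rewrite (derive_comp_real v (C1_near_differentiable cf) ds) derive_sqrt.
Qed.

End RealDerivatives.

Section GraphDivergence.
Variables (R : realType) (n : nat) (g : 'rV[R]_n -> 'M[R]_n) (b : R -> R)
  (f : 'rV[R]_n -> R) (y : 'rV[R]_n).
Hypotheses (cg : C1_mx y g) (gs : (g y)^T = g y)
  (gu : \forall z \near y, g z \in unitmx)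
  (cf : C1_near y f) (cp : C1_mx y (differential f)).

Let p := differential f y.
Let V := p *m invmx (g y).
Let gi := invmx (g y).
Let dg k := 'D_(basis_vec R k) g y.
Let Dg (a : 'rV[R]_n) := \sum_k a 0 k *: dg k.

Definition coord_grad z := differential f z *m invmx (g z).

Lemma C1_mx_coord_grad : C1_mx y coord_grad.
Proof. by apply: C1_mxM cp (C1_mx_inv _ cg); exact: nbhs_singleton gu. Qed.

(** Obtained by differentiating [coord_grad z *m g z = differential f z], valid near [y], and
    solving; the inverse metric is never differentiated explicitly. *)
Lemma derive_coord_grad v :
  'D_v coord_grad y = (v *m coord_hessian f y - V *m Dg v) *m gi.
Proof.
have guy := nbhs_singleton gu.
have E : 'D_v coord_grad y *m g y + V *m Dg v = v *m coord_hessian f y.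
  have -> : Dg v = 'D_v g y.
    by rewrite (derive_basis_sum v (C1_mx_differentiable cg)).
  rewrite -[V]/(coord_grad y) -(derive_mulmx v C1_mx_coord_grad cg).
  rewrite matrix_mulmx_rows -(derive_basis_sum v (C1_mx_differentiable cp)).
  apply: near_eq_derive; apply: filterS gu => z guz.
  by rewrite /coord_grad mulmxKV.
by rewrite -E addrK mulmxK.
Qed.

(** Two of the three derivative terms cancel after exchanging [i] and [d], by symmetry of the
    inverse metric. What remains is the derivative of log sqrt (det g). *)
Lemma christoffel_trace c :
  \sum_i christoffel g y i i c = 2^-1 * \tr (gi *m dg c).
Proof.
have giS : gi^T = gi by rewrite /gi trmx_inv gs.
rewrite -mulr_sumr; congr (_ * _).
pose dG e i j := 'D_(basis_vec R e) (fun z => g z i j) y.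
transitivity (\sum_i \sum_d (gi i d * dG i d c - gi i d * dG d i c)
   + \sum_i \sum_d gi i d * dG c d i).
  rewrite -big_split; apply: eq_bigr => i _; rewrite -big_split.
  apply: eq_bigr => d _ /=; rewrite /dG /gi; ring.
have -> : \sum_i \sum_d (gi i d * dG i d c - gi i d * dG d i c) = 0.
  under eq_bigr => i _ do rewrite sumrB.
  rewrite sumrB exchange_big /= -sumrB big1 // => i _.
  rewrite -sumrB big1 // => d _.
  by rewrite -giS mxE giS subrr.
rewrite add0r /mxtrace; apply: eq_bigr => i _; rewrite mxE.
by apply: eq_bigr => d _; rewrite C1_mx_derive.
Qed.

Lemma coord_divergence (Y : 'rV[R]_n -> 'rV[R]_n) :
  \sum_i (cov_along g id (basis_vec R i) Y y) 0 i =
  \sum_i ('D_(basis_vec R i) Y y) 0 i + 2^-1 * \tr (gi *m Dg (Y y)).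
Proof.
under eq_bigr => i _ do rewrite mxE.
rewrite big_split; congr (_ + _); rewrite /=.
transitivity (\sum_i \sum_c christoffel g y i i c * Y y 0 c).
  apply: eq_bigr => i _; rewrite mxE (bigD1 i) //= [X in _ + X]big1 => [|k ki].
    rewrite addr0; apply: eq_bigr => c _.
    by rewrite derive_id mxE !eqxx mulr1.
  rewrite big1 // => c _; rewrite derive_id mxE eqxx /=.
  by rewrite (negbTE ki) mulr0 mul0r.
rewrite exchange_big /= /Dg mulmx_sumr linear_sum /= mulr_sumr.
apply: eq_bigr => c _; rewrite -mulr_suml christoffel_trace.
by rewrite -scalemxAr mxtraceZ mulrCA mulrC mulrA mulrAC mulrC mulrA.
Qed.

(** Leibniz rule, with the Laplacian as the trace of the Hessian. The half trace left by
    [coord_divergence] supplies the term [2^-1 *: Dg V] of [christoffel_term]. *)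
Lemma divergence_scaled_grad (phi : 'rV[R]_n -> R) : C1_near y phi ->
  \sum_i (cov_along g id (basis_vec R i)
            (fun z => phi z *: coord_grad z) y) 0 i =
  'D_V phi y + phi y * \tr (gi *m covariant_hessian g f y).
Proof.
move=> cphi; rewrite coord_divergence.
have -> : \sum_i ('D_(basis_vec R i) (fun z => phi z *: coord_grad z) y) 0 i =
    'D_V phi y + phi y * \sum_i ('D_(basis_vec R i) coord_grad y) 0 i.
  rewrite (derive_basis_sum V (C1_near_differentiable cphi)) mulr_sumr.
  rewrite -big_split.
  apply: eq_bigr => i _.
  rewrite (derive_scalemx _ cphi C1_mx_coord_grad) !mxE mulrC.
  by [].
rewrite -addrA; congr (_ + _).
have -> : \sum_i ('D_(basis_vec R i) coord_grad y) 0 i =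
    \tr ((coord_hessian f y - \matrix_a (V *m dg a)) *m gi).
  rewrite /mxtrace; apply: eq_bigr => i _; rewrite derive_coord_grad.
  have -> : V *m Dg (basis_vec R i) = basis_vec R i *m \matrix_a (V *m dg a).
    rewrite matrix_mulmx_rows mulmx_sumr; apply: eq_bigr => a _.
    by rewrite -scalemxAr.
  by rewrite -mulmxBr -mulmxA -rowE mxE.
have -> : Dg (phi y *: coord_grad y) = phi y *: Dg V.
  rewrite /Dg scaler_sumr; apply: eq_bigr => k _; by rewrite mxE scalerA.
rewrite -scalemxAr mxtraceZ mulrCA -mulrDr; congr (_ * _).
rewrite mxtrace_mulC -mxtraceZ -mxtraceD scalemxAr -mulmxDr.
congr (\tr (_ *m _)).
by rewrite /covariant_hessian /christoffel_term opprB addrA addrAC.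
Qed.

Let H2 := (V *m covariant_hessian g f y *m V^T) 0 0.
Let n2 z := (coord_grad z *m (differential f z)^T) 0 0.

Lemma C1_near_norm_sq : C1_near y n2.
Proof. exact: (C1_mxM C1_mx_coord_grad (C1_mx_tr cp)). Qed.

(** Metric compatibility in coordinates: the derivatives of [coord_grad] and of the differential
    give twice the coordinate Hessian minus one [Dg V], and on the pair (V, V) [christoffel_term] is
    half of [Dg V]. *)
Lemma derive_norm_sq_grad : 'D_V n2 y = 2 * H2.
Proof.
have cV := C1_mx_coord_grad.
rewrite -(C1_mx_derive V 0 0 (C1_mxM cV (C1_mx_tr cp))).
rewrite (derive_mulmx V cV (C1_mx_tr cp)) (derive_trmx V cp) derive_coord_grad.
have -> : 'D_V (differential f) y = V *m coord_hessian f y.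
  rewrite (derive_basis_sum V (C1_mx_differentiable cp)).
  by rewrite matrix_mulmx_rows.
have giV : gi *m (differential f y)^T = V^T.
  by rewrite /V trmx_mul trmx_inv gs.
rewrite -mulmxA giV mulmxBl addmx00 [X in X + _]addmx00 oppmx00.
rewrite -[coord_grad y]/V -[(V *m (_ *m _)^T) 0 0]trmx00 (trmx_mul V) trmxK.
rewrite /H2 /covariant_hessian /christoffel_term.
rewrite !mulmxBr !mulmxBl.
have -> : V *m (\matrix_(a < n) (V *m dg a)) = V *m Dg V.
  rewrite matrix_mulmx_rows mulmx_sumr; apply: eq_bigr => a _.
  by rewrite -scalemxAr.
rewrite -scalemxAr -scalemxAl !addmx00 !oppmx00 !addmx00 !oppmx00 scalemx00.
by field.
Qed.

End GraphDivergence.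

(** Dictionary: [B], [B1] stand for b, b'; [Q] for q and [s] for its sign; [D] for the Laplacian,
    [H] for Hess f (grad f, grad f), [m] for the dimension. The term [0 * Q] is the derivative of
    the constant sign. *)
Lemma soliton_divergence_algebra (F : fieldType) (m W s Q B B1 D H : F) :
  2 != 0 :> F -> W != 0 -> W ^+ 2 = s * Q -> s != 0 -> Q != 0 -> B != 0 ->
  - B = B ^- 2 *
    (- D + H / (B ^+ 2 * Q) - m * B * B1 - B * B1 * (Q + 1) / Q) <->
  - (B * W) ^- 2 * (B1 * (B ^+ 2 * (Q + 1)) * W + B * ((2 * W)^-1 *
     (0 * Q + s * (2 * H / B ^+ 2 - 2 * B * B1 * (Q + 1) ^+ 2))))
  + (B * W)^-1 * D = W^-1 * (B ^+ 2 - m * B1).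
Proof.
move=> two0 W0 W2 s0 Q0 B0.
have sE : s = W ^+ 2 / Q by rewrite W2 mulfK.
(* Both equations amount to [E = B ^+ 3 - m * B * B1]. *)
pose E := D - H / (B ^+ 2 * Q) + B * B1 * (Q + 1) / Q.
set L := (X in _ <-> X = _).
have -> : L = (B * W)^-1 * E by rewrite /L /E sE; field; rewrite W0 Q0 B0 two0.
have -> : - D + H / (B ^+ 2 * Q) - m * B * B1 - B * B1 * (Q + 1) / Q =
    - E - m * B * B1 by rewrite /E; field; rewrite Q0 B0.
split=> eqE.
  have -> : E = B ^+ 3 - m * B * B1.
    have -> : B ^+ 3 = - (B ^+ 2 * - B) by ring.
    by rewrite eqE; field.
  by field; rewrite W0 B0.
have -> : E = B * W * ((B * W)^-1 * E) by field; rewrite W0 B0.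
by rewrite eqE; field; rewrite W0 B0.
Qed.

(** * From the traced second form to the divergence, at one point of a chart *)

Section SolitonIffDivergence.
Variables (R : realType) (n : nat) (g : 'rV[R]_n -> 'M[R]_n) (b : R -> R)
  (f : 'rV[R]_n -> R) (y : 'rV[R]_n).
Hypotheses (cg : C1_mx y g) (gs : (g y)^T = g y)
  (gu : \forall z \near y, g z \in unitmx)
  (cf : C1_near y f) (cp : C1_mx y (differential f))
  (cb : C1_near (f y) b) (b0 : 0 < b (f y)).

Let p := differential f y.
Let V := p *m invmx (g y).
Let b1 := 'D_1 b (f y).
Let h := b (f y) ^+ 2 *: g y - p^T *m p.
Let q z := (coord_grad g f z *m (differential f z)^T) 0 0 / b (f z) ^+ 2 - 1.
Let Delta := \tr (invmx (g y) *m covariant_hessian g f y).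
Let H2 := (V *m covariant_hessian g f y *m V^T) 0 0.

Hypothesis hu : h \in unitmx.

Let guy : g y \in unitmx. Proof. exact: nbhs_singleton gu. Qed.
Let bn0 : b (f y) != 0. Proof. by rewrite gt_eqF. Qed.
Let q0 : q y != 0. Proof. exact: normal_norm_neq0 hu. Qed.

Lemma grad_norm_sqE : (V *m p^T) 0 0 = b (f y) ^+ 2 * (q y + 1).
Proof. by rewrite /q subrK mulrC divfK ?expf_neq0. Qed.

(** By [graph_pullback_inv] two traces suffice: [trS] against the inverse of [g], and [trVS], which
    is the value of the form on (V, V). *)
Lemma trace_second_form :
  \tr (invmx h *m second_form g b f y) = b (f y) ^- 2 *
   (- Delta + H2 / (b (f y) ^+ 2 * q y) - n%:R * b (f y) * b1
    - b (f y) * b1 * (q y + 1) / q y).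
Proof.
have VT : V^T = invmx (g y) *m p^T by rewrite trmx_mul invmx_sym.
have trS : \tr (invmx (g y) *m second_form g b f y) =
    - Delta - b (f y) * b1 * n%:R
    + 2 * b1 / b (f y) * (b (f y) ^+ 2 * (q y + 1)).
  rewrite /second_form !mulmxDr !mulmxN !mxtraceD !raddfN /= -!scalemxAr.
  rewrite !mxtraceZ mulVmx // mxtrace1 mulmxA -VT.
  rewrite [\tr (V^T *m p)]mxtrace_mulC [\tr (p *m V^T)]trace_mx11.
  by rewrite -trmx00 trmx_mul trmxK grad_norm_sqE.
have trVS : \tr (V^T *m V *m second_form g b f y) =
    - H2 - b (f y) * b1 * (b (f y) ^+ 2 * (q y + 1)) +
     2 * b1 / b (f y) * (b (f y) ^+ 2 * (q y + 1)) ^+ 2.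
  rewrite -mulmxA mxtrace_mulC trace_mx11 /second_form.
  rewrite !mulmxDr !mulmxDl !mulmxN !mulNmx -!scalemxAr -!scalemxAl.
  rewrite !addmx00 !oppmx00 !scalemx00 dual_mul_metric // mulmxA -mulmxA.
  have -> : p *m V^T = (V *m p^T)^T by rewrite (trmx_mul V) trmxK.
  rewrite [V *m p^T]mx11_scalar grad_norm_sqE tr_scalar_mx mul_scalar_mx.
  rewrite scalemx00.
  rewrite !(_ : forall c, (c%:M : 'M[R]_1) 0 0 = c) ?expr2 // => c.
  by rewrite mxE eqxx.
rewrite graph_pullback_inv // -scalemxAl mxtraceZ mulmxBl -scalemxAl raddfB /=.
rewrite mxtraceZ trS trVS -/(q y).
have := q0; move: (q y) => Q Q0; field.
by rewrite Q0 bn0.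
Qed.

Lemma C1_near_normal_norm : C1_near y q.
Proof.
apply: C1_nearB; last exact: C1_near_cst.
apply: C1_nearM; first exact: C1_near_norm_sq.
have cbf := C1_near_comp cf cb.
apply: C1_nearV; first by rewrite expf_neq0.
exact: (C1_nearM cbf cbf).
Qed.

Lemma derive_height : 'D_V f y = b (f y) ^+ 2 * (q y + 1).
Proof.
by rewrite (derive_differential V (C1_near_differentiable cf)) grad_norm_sqE.
Qed.

Lemma derive_b_height :
  'D_V (fun z => b (f z)) y = b1 * (b (f y) ^+ 2 * (q y + 1)).
Proof.
have [df db] := (C1_near_differentiable cf, C1_near_differentiable cb).
by rewrite (derive_comp_real V df db) derive_height.
Qed.

Lemma derive_normal_norm :
  'D_V q y = 2 * H2 / b (f y) ^+ 2 - 2 * b (f y) * b1 * (q y + 1) ^+ 2.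
Proof.
have cbf := C1_near_comp cf cb.
pose B z := b (f z) ^+ 2.
have cbf2 : C1_near y B by exact: (C1_nearM cbf cbf).
have b2n0 : B y != 0 by rewrite expf_neq0.
have cn := C1_near_norm_sq cg gu cp.
have cm := C1_nearM cn (C1_nearV b2n0 cbf2).
have -> : 'D_V q y = 'D_V
    (fun z => (coord_grad g f z *m (differential f z)^T) 0 0 * (B z)^-1) y.
  have := deriveB (C1_near_derivable (v := V) cm)
    (C1_near_derivable (C1_near_cst y (1 : R))).
  by rewrite derive_cst subr0; exact.
rewrite (derive_mul V cn (C1_nearV b2n0 cbf2)) (derive_inv V b2n0 cbf2) /B.
rewrite (derive_mul V cbf cbf) derive_b_height.
rewrite (derive_norm_sq_grad cg gs gu cp).
rewrite -[(coord_grad g f y *m _) 0 0]/((V *m p^T) 0 0) grad_norm_sqE -/H2.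
by field.
Qed.

Let sigma := Num.sg (q y).
(** The factor 1 / (b W) with its sign frozen at [y], which makes it visibly C^1 there. *)
Let phi z := (b (f z) * Num.sqrt (sigma * q z))^-1.

Lemma C1_near_phi : C1_near y phi.
Proof.
have sq0 : 0 < sigma * q y by rewrite /sigma -normrEsg normr_gt0.
have csq : C1_near y (fun z => sigma * q z).
  exact: C1_nearM (C1_near_cst _ _) C1_near_normal_norm.
apply: C1_nearV; first by rewrite mulf_neq0 // gt_eqF ?sqrtr_gt0.
by apply: C1_nearM (C1_near_comp cf cb) _; exact: C1_near_sqrt.
Qed.

Lemma soliton_iff_divergence :
  - b (f y) = \tr (invmx h *m second_form g b f y) <->
  \sum_i (cov_along g id (basis_vec R i)
            (fun z => phi z *: coord_grad g f z) y) 0 i =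
  (Num.sqrt (sigma * q y))^-1 * (b (f y) ^+ 2 - n%:R * b1).
Proof.
pose sq z := sigma * q z.
have sq0 : 0 < sq y by rewrite /sq /sigma -normrEsg normr_gt0.
have csq : C1_near y sq.
  exact: C1_nearM (C1_near_cst _ _) C1_near_normal_norm.
have cbf := C1_near_comp cf cb.
rewrite (divergence_scaled_grad cg gs gu cp C1_near_phi) trace_second_form.
have Wn0 : Num.sqrt (sigma * q y) != 0 by rewrite gt_eqF ?sqrtr_gt0.
have cW : C1_near y (fun z => Num.sqrt (sq z)) by exact: C1_near_sqrt.
pose bW z := b (f z) * Num.sqrt (sq z).
have cbW : C1_near y bW by exact: (C1_nearM cbf cW).
have bWn0 : bW y != 0 by rewrite mulf_neq0.
rewrite [X in _ <-> X + _ = _](derive_inv _ bWn0 cbW).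
rewrite (derive_mul _ cbf cW) (derive_sqrt_comp _ sq0 csq).
rewrite (derive_mul _ (C1_near_cst y sigma) C1_near_normal_norm) derive_cst.
rewrite derive_b_height derive_normal_norm /phi -/Delta /bW /sq.
have W2 : Num.sqrt (sigma * q y) ^+ 2 = sigma * q y by rewrite sqr_sqrtr ?ltW.
have sigma0 : sigma != 0 by rewrite /sigma sgr_eq0.
by apply: soliton_divergence_algebra.
Qed.

End SolitonIffDivergence.

(** * Charts *)

Lemma nondegenerate_mx_unit (R : realType) m (G : 'M[R]_m) :
  nondegenerate_mx G -> G \in unitmx.
Proof.
move=> Gn; rewrite -row_free_unit; apply/inj_row_free => v vG.
by apply: Gn => w; rewrite /gdot vG mul0mx mxE.
Qed.

Lemma posdef_mx_unit (R : realType) m (G : 'M[R]_m) :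
  (forall v, v != 0 -> 0 < gdot G v v) -> G \in unitmx.
Proof.
move=> Gp; apply: nondegenerate_mx_unit => v Gv.
apply/eqP; apply: contraT => v0; have := Gp v v0.
by rewrite Gv ltxx.
Qed.

Lemma derive_comp (R : realType) (U V W : normedModType R) (T : U -> V)
    (h : V -> W) z v :
  differentiable T z -> differentiable h (T z) ->
  'D_v (h \o T) z = 'D_('D_v T z) h (T z).
Proof.
move=> dT dh; rewrite (deriveE v (differentiable_comp dT dh)).
by rewrite diff_comp //= (deriveE _ dh) (deriveE _ dT).
Qed.

Lemma differential_comp (R : realType) n (T : 'rV[R]_n -> 'rV[R]_n)
    (h : 'rV[R]_n -> R) z :
  differentiable T z -> differentiable h (T z) ->
  differential (h \o T) z = differential h (T z) *m ('J T z)^T.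
Proof.
move=> dT dh; apply/rowP => i; rewrite mxE (derive_comp _ dT dh).
rewrite (derive_differential _ dh) (deriveEjacobian _ dT).
rewrite /basis_vec -mulmxA -rowE mxE.
by rewrite -['J T z *m _]trmxK trmx_mul trmxK mxE.
Qed.

Lemma differential_near_eq (R : realType) n (h k : 'rV[R]_n -> R) z :
  (\forall w \near z, h w = k w) -> differential h z = differential k z.
Proof. by move=> hk; apply/rowP => i; rewrite !mxE; exact: near_eq_derive. Qed.

Lemma Ck1_C1_near (R : realType) (V : normedModType R) (D : set V)
    (f : V -> R) x :
  open D -> D x -> Ck 1 D f -> C1_near x f.
Proof.
move=> oD Dx [df cf]; rewrite /C1_near.
have nD : nbhs x D by exact: open_nbhs_nbhs.
by apply: filterS nD => z Dz; split=> [|v]; [exact: df|exact: cf].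
Qed.

Lemma Ck2_C1_near (R : realType) (V : normedModType R) (D : set V)
    (f : V -> R) x :
  open D -> D x -> Ck 2 D f -> C1_near x f.
Proof.
move=> oD Dx [df cf]; apply: Ck1_C1_near oD Dx _; split=> // v z Dz.
by have [/(_ z Dz) + _] := cf v; exact: differentiable_continuous.
Qed.

Lemma Ck2_C1_differential (R : realType) n (D : set 'rV[R]_n)
    (f : 'rV[R]_n -> R) y :
  open D -> D y -> Ck 2 D f -> C1_mx y (differential f).
Proof.
move=> oD Dy [_ cf] i j.
have -> : (fun z => differential f z i j) = 'D_(basis_vec R j) f.
  by apply/funext => z; rewrite mxE.
exact: (Ck1_C1_near oD Dy).
Qed.

Lemma cov_along_near_eq (R : realType) n m (G : 'rV[R]_m -> 'M[R]_m)
    (f : 'rV[R]_n -> 'rV[R]_m) v Y Z y : (\forall z \near y, Y z = Z z) ->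
  cov_along G f v Y y = cov_along G f v Z y.
Proof.
move=> YZ; rewrite /cov_along (near_eq_derive v YZ).
by rewrite (nbhs_singleton YZ).
Qed.

Section Charts.
Variables (R : realType) (n : nat) (N : riemannian_manifold R n).
Implicit Types (phi psi : chart R n N) (f : N -> R) (O : set N).

(** [cinv] is meaningful only on the chart image, so its preimage of the open set is intersected
    with that image. *)
Lemma near_chart phi O x : open O -> cdom phi x -> O x ->
  \forall z \near cmap phi x, (cmap phi @` (cdom phi `&` O)) z.
Proof.
move=> oO dx Ox.
have img : nbhs (cmap phi x) (cmap phi @` cdom phi).
  by apply: open_nbhs_nbhs; split; [exact: cimg_open|exists x].
have xO : nbhs (cinv phi (cmap phi x)) (cdom phi `&` O).
  rewrite cmapK //; apply: open_nbhs_nbhs; split=> //.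
  by apply: openI => //; exact: cdom_open.
have cx : {for cmap phi x, continuous (cinv phi)}.
  by apply: cinv_continuous; exists x.
have pre : nbhs (cmap phi x) [set z | (cdom phi `&` O) (cinv phi z)].
  exact: cx _ xO.
apply: filterS2 img pre => _ [p dp <-] /=; rewrite cmapK // => dO.
by exists p.
Qed.

Lemma open_chart phi O : open O -> open (cmap phi @` (cdom phi `&` O)).
Proof.
move=> oO; rewrite openE => _ [x [dx Ox] <-]; exact: near_chart.
Qed.

Lemma metric_unit phi z : atlas phi -> (cmap phi @` cdom phi) z ->
  metric phi z \in unitmx.
Proof. by move=> aphi iz; exact: posdef_mx_unit (metric_pos aphi iz). Qed.

Lemma gdot_grad f phi z : atlas phi -> (cmap phi @` cdom phi) z ->
  gdot (metric phi z) (grad f phi z) (grad f phi z) =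
  (coord_grad (metric phi) (f \o cinv phi) z
    *m (differential (f \o cinv phi) z)^T) 0 0.
Proof.
move=> aphi iz; rewrite /gdot.
have -> : grad f phi z = coord_grad (metric phi) (f \o cinv phi) z by [].
rewrite {1}/coord_grad mulmxKV ?metric_unit //.
by rewrite -[LHS]trmx00 trmx_mul trmxK.
Qed.

(** Needed because [norm_grad_sq] changes chart with the point. With [J] the Jacobian of the
    transition, the differential acquires [J^T] and the metric becomes [J *m g *m J^T], so [J]
    cancels. *)
Lemma norm_grad_sq_chart f phi p (Omega : set N) : open Omega -> Omega p ->
  CkN 2 Omega f -> atlas phi -> cdom phi p ->
  norm_grad_sq f p =
  (coord_grad (metric phi) (f \o cinv phi) (cmap phi p)
    *m (differential (f \o cinv phi) (cmap phi p))^T) 0 0.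
Proof.
move=> oO Op f2 aphi dp; set psi := chart_at p; set z := cmap phi p.
have apsi : atlas psi by exact: chart_at_atlas.
have dpsi : cdom psi p by exact: chart_at_dom.
rewrite /norm_grad_sq gdot_grad //.
pose T := transition phi psi.
have Tz : T z = cmap psi p by rewrite /T /transition /z cmapK.
have oz : overlap phi psi z by exists p.
have dT : differentiable T z.
  by have [dT _] := atlas_smooth aphi apsi 1%N; exact: dT.
have df : differentiable (f \o cinv psi) (T z).
  have [df _] := f2 psi apsi; rewrite Tz; apply: df; by exists p.
have fE : \forall w \near z, (f \o cinv phi) w = ((f \o cinv psi) \o T) w.
  have := near_chart (@cdom_open _ _ _ psi) dp dpsi.
  apply: filterS => _ [p' [dp' dp''] <-] /=.
  by rewrite /T /transition !cmapK.
have dE : differential (f \o cinv phi) z =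
    differential (f \o cinv psi) (cmap psi p) *m ('J T z)^T.
  by rewrite (differential_near_eq fE) differential_comp // Tz.
have gE : metric phi z = 'J T z *m metric psi (cmap psi p) *m ('J T z)^T.
  by rewrite (metric_transition aphi apsi oz) /pullback -/T Tz.
have gu : metric phi z \in unitmx by apply: metric_unit => //; exists p.
rewrite /coord_grad dE gE; move: gu; rewrite gE !unitmx_mul unitmx_tr.
move: ('J T z) (metric psi _) (differential _ _) => J g d.
(* Invertibility of [J] is extracted from that of the transformed metric. *)
move=> /andP[/andP[Ju gu] _].
have JTu : J^T \in unitmx by rewrite unitmx_tr.
have -> : invmx (J *m g *m J^T) = invmx J^T *m invmx g *m invmx J.
  have Mu : J *m g *m J^T \in unitmx by rewrite !unitmx_mul Ju gu.
  apply: (can_inj (mulKmx Mu)); rewrite mulmxV //.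
  by rewrite !mulmxA mulmxK // mulmxK // mulmxV.
rewrite trmx_mul trmxK !mulmxA; congr ((_ *m _) 0 0).
by rewrite mulmxK // mulmxKV.
Qed.

End Charts.

Lemma near_sgr (R : realType) (T : topologicalType) (q : T -> R) (y : T) :
  q y != 0 -> {for y, continuous q} ->
  \forall z \near y, Num.sg (q z) = Num.sg (q y).
Proof.
move=> q0 cq; have [qy|qy|/eqP qy] := ltgtP (q y) 0; last first.
- by rewrite (negbTE q0) in qy.
- have : \forall z \near y, 0 < q z.
    exact: (cq _ (open_nbhs_nbhs (conj (@open_gt R 0) qy))).
  by apply: filterS => z qz; rewrite !gtr0_sg.
- have : \forall z \near y, q z < 0.
    exact: (cq _ (open_nbhs_nbhs (conj (@open_lt R 0) qy))).
  by apply: filterS => z qz; rewrite !ltr0_sg.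
Qed.

(** * The equivalence on the manifold for a single height function *)

Section LocalStatement.
Variables (R : realType) (n : nat) (N : riemannian_manifold R n)
  (I : set R) (b : R -> R) (Omega : set N) (f : N -> R).
Hypotheses (I_open : open I) (b_pos : forall s, I s -> 0 < b s)
  (b_smooth : smooth I b) (Omega_open : open Omega)
  (f_I : forall x, Omega x -> I (f x)) (f_C2 : CkN 2 Omega f)
  (f_nondeg : graph_nondegenerate b Omega f).

Lemma mean_curvature_iff_div x (phi := chart_at x) (y := cmap phi x)
    (G := warped_metric b phi) (F := graph f phi) : Omega x ->
  is_mean_curvature_vector G F y (b (f x) *: normal_proj G F y (dt_vec R n)) <->
  div (scale_field (fun p => (b (f p) * W b f p)^-1) (grad f)) x =
  (W b f x)^-1 * (b (f x) ^+ 2 - n%:R * derive1 b (f x)).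
Proof.
move=> Ox.
have aphi : atlas phi by exact: chart_at_atlas.
have dx : cdom phi x by exact: chart_at_dom.
pose fc := f \o cinv phi.
pose g := metric phi.
have fcy : fc y = f x by rewrite /fc /y /= cmapK.
have oD : open (cmap phi @` (cdom phi `&` Omega)) by exact: open_chart.
have Dy : (cmap phi @` (cdom phi `&` Omega)) y by exists x.
have iy : (cmap phi @` cdom phi) y by exists x.
have img := @cimg_open _ _ _ phi.
have nimg : \forall z \near y, (cmap phi @` cdom phi) z.
  exact: open_nbhs_nbhs.
have cg : C1_mx y g.
  exact: Ck1_C1_mx img iy (metric_smooth aphi 1%N).
have gs : \forall z \near y, (g z)^T = g z.
  by apply: filterS nimg => z; exact: (Defs.metric_sym aphi).
have gu : \forall z \near y, g z \in unitmx.
  by apply: filterS nimg => z; exact: (metric_unit aphi).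
have cf : C1_near y fc by exact: Ck2_C1_near oD Dy (f_C2 aphi).
have cp : C1_mx y (differential fc).
  exact: Ck2_C1_differential oD Dy (f_C2 aphi).
have cb : C1_near (fc y) b.
  by rewrite fcy; exact: Ck1_C1_near I_open (f_I Ox) (b_smooth 1%N).
have b0 : 0 < b (fc y) by rewrite fcy; exact: b_pos (f_I Ox).
have bn0 : b (fc y) != 0 by rewrite gt_eqF.
have hu : b (fc y) ^+ 2 *: g y - (differential fc y)^T *m differential fc y
    \in unitmx.
  rewrite -(graph_pullback g b cf).
  exact: nondegenerate_mx_unit (f_nondeg Ox).
have mcE := @graph_mean_curvature R n g b fc y cg gs (nbhs_singleton gu)
  cf cp cb bn0 hu (b (f x)).
apply: iff_trans mcE _.
have divE := @soliton_iff_divergence R n g b fc y cg (nbhs_singleton gs) gu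
  cf cp cb b0 hu.
rewrite -{1}fcy; apply: iff_trans divE _.
pose q z :=
  (coord_grad g fc z *m (differential fc z)^T) 0 0 / b (fc z) ^+ 2 - 1.
have fcE p : cdom phi p -> fc (cmap phi p) = f p.
  by move=> dp; rewrite /fc /= cmapK.
have qE p : cdom phi p -> Omega p ->
    norm_grad_sq f p / b (f p) ^+ 2 - 1 = q (cmap phi p).
  move=> dp Op; rewrite (norm_grad_sq_chart Omega_open Op f_C2 aphi dp).
  by rewrite /q fcE.
have WE p : cdom phi p -> Omega p ->
    W b f p = Num.sqrt (Num.sg (q (cmap phi p)) * q (cmap phi p)).
  by move=> dp Op; rewrite /W /eps_hat qE.
have q0 : q y != 0 by exact: normal_norm_neq0 (nbhs_singleton gu) bn0 hu.
have cq : C1_near y q by exact: C1_near_normal_norm.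
have sgq : \forall z \near y, Num.sg (q z) = Num.sg (q y).
  exact: near_sgr q0 (C1_near_continuous cq).
rewrite WE // -/y derive1E -fcy.
suff -> : div (scale_field (fun p => (b (f p) * W b f p)^-1) (grad f)) x =
    \sum_i (cov_along g id (basis_vec R i)
      (fun z => (b (fc z) * Num.sqrt (Num.sg (q y) * q z))^-1
        *: coord_grad g fc z) y) 0 i.
  by [].
rewrite /div -/phi -/y; apply: eq_bigr => i _.
congr ((_ : 'rV[R]_n) 0 i); apply: cov_along_near_eq.
have nD : \forall z \near y, (cmap phi @` (cdom phi `&` Omega)) z.
  exact: open_nbhs_nbhs.
apply: filterS2 sgq nD => z sgz [p [dp Op] pz].
rewrite /scale_field -pz cmapK // WE // pz sgz.
by rewrite -pz fcE.
Qed.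

End LocalStatement.

(** * The flow *)

Section Antiderivative.
Variables (R : realType) (I : set R) (k : R -> R).
Hypotheses (I_open : open I) (I_itv : is_interval I)
  (k_cont : forall s, I s -> {for s, continuous k}).
Notation mu := (@lebesgue_measure R).

Lemma integrable_segment a c : I a -> I c -> mu.-integrable `[a, c] (EFin \o k).
Proof.
move=> Ia Ic; apply: continuous_compact_integrable.
  exact: segment_compact.
apply: continuous_in_subspaceT => s; rewrite inE /= in_itv /= => acs.
by apply: k_cont; exact: I_itv Ia Ic _ acs.
Qed.

Let prim a z := \int[mu]_(t in `[a, z]) k t.

Lemma prim_le a z : z <= a -> prim a z = 0.
Proof.
rewrite le_eqVlt => /predU1P[->|za].
  by rewrite /prim set_itv1 Rintegral_set1.
by rewrite /prim set_itv_ge ?Rintegral_set0 // bnd_simp -ltNge.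
Qed.

Lemma prim_sub a c z : I a -> I z -> a <= c <= z ->
  prim a z - prim a c = prim c z.
Proof.
move=> Ia Iz /andP[ac cz].
rewrite /prim Rintegral_itvB ?bnd_simp //; last exact: integrable_segment.
rewrite Rintegral_itv_obnd_cbnd //.
apply: integrableS (integrable_segment Ia Iz) => //.
by apply: subset_itvr; rewrite bnd_simp.
Qed.

Lemma open_interval_bounds s : I s -> exists a c, [/\ I a, I c & a < s < c].
Proof.
move=> Is; have /nbhs_ballP[e /= e0 eI] : nbhs s I by exact: open_nbhs_nbhs.
have e2 : 0 < e / 2 by rewrite divr_gt0.
have e2e : e / 2 < e by rewrite ltr_pdivrMr // ltr_pMr // ltr1n.
exists (s - e / 2), (s + e / 2); split.
- by apply: eI; rewrite /ball /= opprB addrC subrK gtr0_norm.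
- by apply: eI; rewrite /ball /= opprD addrA subrr sub0r normrN gtr0_norm.
- by rewrite ltrBlDr !ltrDl e2.
Qed.

Lemma antiderivative :
  exists B : R -> R, forall s, I s -> is_derive s 1 B (k s).
Proof.
have [[c0 Ic0]|I0] := pselect (exists c, I c); last first.
  by exists (fun=> 0) => s Is; case: I0; exists s.
exists (fun z => prim c0 z - prim z c0) => s Is.
have Im : I (Num.min s c0) by rewrite /Num.min; case: ifP.
have [a [_ [Ia _ /andP[am _]]]] := open_interval_bounds Im.
have [_ [w [_ Iw /andP[_ sw]]]] := open_interval_bounds Is.
move: am; rewrite lt_min => /andP[as_ ac].
have [dp pE] := @continuous_FTC1_closed R k a s w sw
  (integrable_segment Ia Iw) as_ (k_cont Is).
have nearI : \forall z \near s, I z by exact: open_nbhs_nbhs.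
have neara : \forall z \near s, a < z.
  exact: (open_nbhs_nbhs (conj (@open_gt R a) as_)).
(* Since [a] lies to the left of both [s] and [c0], the oriented integral near [s] is [prim a] up to
   a constant, and the fundamental theorem applies at the interior point [s] of [a, w]. *)
apply: (@near_eq_is_derive _ _ _ (fun z => prim a z - prim a c0)).
  apply: filterS2 nearI neara => z Iz az.
  have [cz|zc] := leP c0 z.
    by rewrite (prim_sub Ia Iz) ?(ltW ac) ?cz // (prim_le cz) subr0.
  rewrite (prim_le (ltW zc)) sub0r -(@prim_sub a z c0 Ia Ic0) ?opprB //.
  by rewrite (ltW az) (ltW zc).
have -> : k s = k s - 0 by rewrite subr0.
apply: is_deriveB.
by rewrite derive1E in pE; exact: DeriveDef dp pE.
Qed.

End Antiderivative.

Lemma derive0_segment (R : realType) (f : R -> R) (a c : R) : a <= c ->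
  (forall s, a <= s <= c -> is_derive s 1 f 0) -> f a = f c.
Proof.
move=> ac df.
have cf : {within `[a, c], continuous f}.
  apply: continuous_in_subspaceT => s; rewrite inE /= in_itv /= => /df[ds _].
  exact/differentiable_continuous/derivable1_diffP.
have [s|s _] := @MVT_segment R f (fun=> 0) a c ac _ cf.
  by rewrite in_itv /= => /andP[/ltW as_ /ltW sc]; apply: df; rewrite as_ sc.
by rewrite mul0r => /subr0_eq ->.
Qed.

Section Flow.
Variables (R : realType) (I S : set R) (b : R -> R) (A : R -> R -> R) (eps : R).
Hypotheses (I_open : open I) (I_itv : is_interval I)
  (b_pos : forall s, I s -> 0 < b s)
  (b_cont : forall s, I s -> {for s, continuous b})
  (eps_gt0 : 0 < eps) (A_flow : is_flow b I S A eps).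

Lemma flow_domain s : S s -> I s.
Proof.
move=> Ss; have [A0 /(_ 0)] := A_flow Ss.
by rewrite normr0 A0 => /(_ eps_gt0)[].
Qed.

Section Time.
Variable B : R -> R.
Hypothesis dB : forall s, I s -> is_derive s 1 B (b s)^-1.

Lemma time_increasing s r : I s -> I r -> s < r -> B s < B r.
Proof.
move=> Is Ir sr.
have sI z : z \in `[s, r] -> I z by rewrite in_itv /=; exact: I_itv.
have cB : {within `[s, r], continuous B}.
  apply: continuous_in_subspaceT => z; rewrite inE /= => /sI /dB[dz _].
  exact/differentiable_continuous/derivable1_diffP.
have [z|z zsr] := @MVT R B (fun z => (b z)^-1) s r sr _ cB.
  by move=> /subset_itv_oo_cc /sI; exact: dB.
rewrite -[B s < B r]subr_gt0 => ->.
by rewrite mulr_gt0 ?subr_gt0 // invr_gt0; apply/b_pos/sI/subset_itv_oo_cc.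
Qed.

Lemma time_inj s r : I s -> I r -> B s = B r -> s = r.
Proof.
move=> Is Ir Bsr; have [sr|rs|//] := ltgtP s r.
  by have := time_increasing Is Ir sr; rewrite Bsr ltxx.
by have := time_increasing Ir Is rs; rewrite Bsr ltxx.
Qed.

(** [B] measures time along the flow: by the chain rule [B (A s r) - r] has zero derivative in
    [r]. *)
Lemma flow_time s t : S s -> `|t| < eps -> B (A s t) = B s + t.
Proof.
move=> Ss te; have [A0 As] := A_flow Ss.
have dth (r : R) : `|r| < eps -> is_derive r (1 : R) (fun r => B (A s r) - r) 0.
  move=> re; have [IA dA] := As _ re.
  have -> : 0 = (b (A s r))^-1 * b (A s r) - 1.
    by rewrite mulVf ?subrr // gt_eqF ?b_pos.
  by apply: is_deriveB; have dBA := dB IA; exact: is_derive1_comp.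
suff : B (A s 0) - 0 = B (A s t) - t by rewrite A0 subr0 => ->; rewrite subrK.
have [t0|t0] := leP 0 t.
  apply: (derive0_segment (f := fun r => B (A s r) - r)) t0 _ => r /andP[r0 rt].
  by apply: dth; rewrite (le_lt_trans _ te) // !ger0_norm // (le_trans r0).
apply/esym.
apply: (derive0_segment (f := fun r => B (A s r) - r)) (ltW t0) _ => r.
move=> /andP[tr r0].
by apply: dth; rewrite (le_lt_trans _ te) // !ler0_norm ?lerN2 // ltW.
Qed.

(** Inverse of [B] on the image of [I]; the value 0 elsewhere is arbitrary. *)
Let Binv z := xget 0 [set r | I r /\ B r = z].

Lemma timeK r : I r -> Binv (B r) = r.
Proof.
move=> Ir; rewrite /Binv; case: xgetP => [w _ [Iw Bw]|/(_ r)].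
  exact: time_inj.
by case; split.
Qed.

Lemma derive_time_inv r : I r -> is_derive (B r) 1 Binv (b r).
Proof.
move=> Ir; rewrite -[b r]invrK.
have nearI : \forall z \near r, I z by exact: open_nbhs_nbhs.
apply: is_derive_inverse (dB Ir) _.
- by apply: filterS nearI => z; exact: timeK.
- apply: filterS nearI => z /dB[dz _].
  exact/differentiable_continuous/derivable1_diffP.
- by rewrite invr_eq0 gt_eqF ?b_pos.
Qed.

(** The function [psi] is defined on the whole line, so its derivative makes sense at points of [S]
    even where [S] has empty interior, as for a constant height. *)
Lemma flow_map_time t : `|t| < eps -> exists psi : R -> R, forall s, S s ->
  A s t = psi s /\ is_derive s 1 psi (b (A s t) / b s).
Proof.
move=> te; exists (fun s => Binv (B s + t)) => s Ss.
have [IA _] := (A_flow Ss).2 _ te.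
have BA := flow_time Ss te.
split; first by rewrite -BA timeK.
have dBt : is_derive s 1 (fun s => B s + t) (b s)^-1.
  have dBs := dB (flow_domain Ss).
  have -> : (b s)^-1 = (b s)^-1 + 0 by rewrite addr0.
  exact: is_deriveD.
have dinv : is_derive (B s + t) 1 Binv (b (A s t)).
  by rewrite -BA; exact: derive_time_inv.
exact: (@is_derive1_comp _ Binv (fun s => B s + t)).
Qed.

End Time.

Lemma flow_map_derivable t : `|t| < eps -> exists psi : R -> R, forall s, S s ->
  A s t = psi s /\ is_derive s 1 psi (b (A s t) / b s).
Proof.
have [s Is|B dB] := @antiderivative R I (fun s => (b s)^-1) I_open I_itv.
  by apply: continuousV; [rewrite gt_eqF ?b_pos|exact: b_cont].
exact: flow_map_time dB t.
Qed.

End Flow.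

(** * Regularity of the transported height in a chart *)

Section FlowChart.
Variables (R : realType) (V : normedModType R) (D : set V) (I S : set R)
  (b : R -> R) (A : R -> R -> R) (eps : R) (v : V -> R).
Hypotheses (I_open : open I) (I_itv : is_interval I)
  (b_pos : forall s, I s -> 0 < b s) (b_smooth : smooth I b)
  (eps_gt0 : 0 < eps) (A_flow : is_flow b I S A eps)
  (D_open : open D) (v_S : forall y, D y -> S (v y)) (v_C2 : Ck 2 D v).

Let b_cont s : I s -> {for s, continuous b}.
Proof. exact: b_smooth 0%N s. Qed.

Let f t y := A (v y) t.

Lemma flow_chart_derive t y : `|t| < eps -> D y ->
  differentiable (f t) y /\
  forall w, 'D_w (f t) y = b (f t y) / b (v y) * 'D_w v y.
Proof.
move=> te Dy.
have [psi psiE] :=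
  flow_map_derivable I_open I_itv b_pos b_cont eps_gt0 A_flow te.
have nD : nbhs y D by exact: open_nbhs_nbhs.
have fE : \forall z \near y, psi (v z) = f t z.
  by apply: filterS nD => z /v_S /psiE[].
have [dv _] := v_C2.
have [_ [dpsi dpsiE]] := psiE _ (v_S Dy).
move/derivable1_diffP : dpsi => dpsi.
split=> [|w].
  apply: near_eq_differentiable fE _.
  exact: (differentiable_comp (dv y Dy) dpsi).
rewrite -(near_eq_derive w fE) (derive_comp_real w (dv y Dy) dpsi).
by rewrite dpsiE.
Qed.

Lemma flow_chart_C2 t : `|t| < eps -> Ck 2 D (f t).
Proof.
move=> te; split=> [y Dy|w]; first by have [] := flow_chart_derive te Dy.
suff cw y : D y -> C1_near y ('D_w (f t)).
  by split=> [y /cw /nbhs_singleton[]|z y /cw /nbhs_singleton[_]].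
move=> Dy.
have nD : nbhs y D by exact: open_nbhs_nbhs.
have If z : D z -> I (f t z).
  by move=> /v_S Sz; have [_ /(_ t te)[]] := A_flow Sz.
have Iv z : D z -> I (v z) by move=> /v_S; exact: flow_domain eps_gt0 A_flow _.
have cb s : I s -> C1_near s b.
  by move=> Is; exact: Ck1_C1_near I_open Is (b_smooth 1%N).
have cv z : D z -> C1_near z v by move=> Dz; exact: Ck2_C1_near D_open Dz v_C2.
(* Bootstrap: the formula for the derivative contains [f t] itself, so [f t] must be C^1 before its
   derivative can be. *)
have cf : C1_near y (f t).
  apply: filterS nD => z Dz; have [df fE] := flow_chart_derive te Dz.
  split=> // w'.
  apply: (@near_eq_continuous_for _ _
      (fun z => b (f t z) / b (v z) * 'D_w' v z)).
    have nDz : nbhs z D by exact: open_nbhs_nbhs.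
    by apply: filterS nDz => z' Dz'; have [_ ->] := flow_chart_derive te Dz'.
  have [_ cv'] := nbhs_singleton (cv z Dz).
  apply: continuousM (cv' w'); apply: continuousM.
    by apply: (@continuous_comp _ _ _ (f t) b);
      [exact: differentiable_continuous|apply: b_cont; exact: If].
  apply: continuousV; first by rewrite gt_eqF // b_pos //; exact: Iv.
  by apply: (@continuous_comp _ _ _ v b);
    [exact: C1_near_continuous (cv z Dz)|apply: b_cont; exact: Iv].
have cDv : C1_near y ('D_w v).
  by have [_ /(_ w)] := v_C2; exact: Ck1_C1_near D_open Dy.
apply: (@C1_near_eq _ _ _ (fun z => b (f t z) / b (v z) * 'D_w v z)).
  by apply: filterS nD => z Dz; have [_ ->] := flow_chart_derive te Dz.
apply: C1_nearM cDv; apply: C1_nearM.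
  exact: C1_near_comp cf (cb _ (If _ Dy)).
apply: C1_nearV; first by rewrite gt_eqF // b_pos //; exact: Iv.
exact: C1_near_comp (cv y Dy) (cb _ (Iv _ Dy)).
Qed.

End FlowChart.

(** * Quantities invariant along the flow *)

Section FlowManifold.
Variables (R : realType) (n : nat) (N : riemannian_manifold R n)
  (I : set R) (b : R -> R) (Omega : set N) (u : N -> R)
  (A : R -> R -> R) (eps : R).
Hypotheses (I_open : open I) (I_itv : is_interval I)
  (b_pos : forall s, I s -> 0 < b s) (b_smooth : smooth I b)
  (Omega_open : open Omega) (u_C2 : CkN 2 Omega u)
  (eps_gt0 : 0 < eps) (A_flow : is_flow b I (u @` Omega) A eps).
Variable t : R.
Hypothesis t_eps : `|t| < eps.

Let ut x := A (u x) t.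

Let chart_height (phi : chart R n N) z : (cmap phi @` (cdom phi `&` Omega)) z ->
  (u @` Omega) ((u \o cinv phi) z).
Proof. by move=> [p [dp Op] <-]; exists p => //=; rewrite cmapK. Qed.

Lemma flow_height_C2 : CkN 2 Omega ut.
Proof.
move=> phi aphi.
have := flow_chart_C2 I_open I_itv b_pos b_smooth eps_gt0 A_flow
  (open_chart Omega_open) (@chart_height phi) (u_C2 aphi) t_eps.
exact.
Qed.

Lemma flow_height_I x : Omega x -> I (ut x).
Proof.
move=> Ox; have Su : (u @` Omega) (u x) by exists x.
by have [_ /(_ t t_eps)[]] := A_flow Su.
Qed.

Lemma grad_flow_height (phi : chart R n N) z : atlas phi ->
  (cmap phi @` (cdom phi `&` Omega)) z ->
  grad ut phi z = (b (ut (cinv phi z)) / b (u (cinv phi z))) *: grad u phi z.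
Proof.
move=> aphi Dz; rewrite /grad scalemxAl; congr (_ *m _).
have [_ fE] := flow_chart_derive I_open I_itv b_pos b_smooth eps_gt0 A_flow
  (open_chart Omega_open) (@chart_height phi) (u_C2 aphi) t_eps Dz.
apply/rowP => i; rewrite !mxE; exact: fE.
Qed.

Lemma norm_grad_sq_flow x : Omega x ->
  norm_grad_sq ut x / b (ut x) ^+ 2 = norm_grad_sq u x / b (u x) ^+ 2.
Proof.
move=> Ox; rewrite /norm_grad_sq grad_flow_height; last 2 first.
- exact: chart_at_atlas.
- by exists x; split=> //; exact: chart_at_dom.
rewrite cmapK; last exact: chart_at_dom.
rewrite /gdot linearZ /= -!scalemxAl -scalemxAr !scalemx00.
have bu : b (u x) != 0.
  rewrite gt_eqF // b_pos //; apply: (flow_domain eps_gt0 A_flow).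
  by exists x.
have but : b (ut x) != 0 by rewrite gt_eqF // b_pos //; exact: flow_height_I.
by field; rewrite bu but.
Qed.

Lemma W_flow x : Omega x -> W b ut x = W b u x.
Proof. by move=> Ox; rewrite /W /eps_hat norm_grad_sq_flow. Qed.

(** The factor b u_t / b u of the gradient cancels b u_t in the denominator. The fields agree on a
    neighbourhood of [x], which is all that the covariant derivative sees. *)
Lemma div_flow x : Omega x ->
  div (scale_field (fun p => (b (ut p) * W b ut p)^-1) (grad ut)) x =
  div (scale_field (fun p => (b (u p) * W b u p)^-1) (grad u)) x.
Proof.
move=> Ox; rewrite /div; apply: eq_bigr => i _.
apply: (congr1 (fun w : 'rV[R]_n => w 0 i)); apply: cov_along_near_eq.
have nD := near_chart Omega_open (chart_at_dom x) Ox.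
apply: filterS nD => z Dz; rewrite /scale_field.
rewrite (grad_flow_height (chart_at_atlas x) Dz).
have Oz : Omega (cinv (chart_at x) z).
  by case: Dz => p [dp Op] <-; rewrite cmapK.
have but : b (ut (cinv (chart_at x) z)) != 0.
  by rewrite gt_eqF // b_pos //; exact: flow_height_I.
rewrite W_flow // scalerA !invfM; congr (_ *: _).
by rewrite mulrACA mulVf // mul1r mulrC.
Qed.

End FlowManifold.

Theorem proposition3p6 (R : realType) (n : nat) (N : riemannian_manifold R n)
    (I : set R) (b : R -> R) (Omega : set N) (u : N -> R)
    (A : R -> R -> R) (eps : R)
    (I_open : open I) (I_itv : is_interval I)
    (b_pos : forall s, I s -> 0 < b s) (b_smooth : smooth I b)
    (Omega_open : open Omega) (Omega_precompact : compact (closure Omega))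
    (Omega_connected : connected Omega)
    (u_I : forall x, Omega x -> I (u x)) (u_C2 : CkN 2 Omega u)
    (F0_nondeg : graph_nondegenerate b Omega u)
    (eps_gt0 : 0 < eps) (A_flow : is_flow b I (u @` Omega) A eps)
    (Ft_nondeg : forall t, `|t| < eps ->
       graph_nondegenerate b Omega (fun x => A (u x) t)) :
  X_soliton b Omega (fun t x => A (u x) t) eps <->
  (forall x t, Omega x -> `|t| < eps ->
     div (scale_field (fun p => (b (u p) * W b u p)^-1) (grad u)) x =
     (W b u x)^-1 * (b (A (u x) t) ^+ 2 - n%:R * derive1 b (A (u x) t))).
Proof.
have pointwise x t : Omega x -> `|t| < eps ->
  is_mean_curvature_vector (warped_metric b (chart_at x))
    (graph (fun x => A (u x) t) (chart_at x)) (cmap (chart_at x) x)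
    (b (A (u x) t) *: normal_proj (warped_metric b (chart_at x))
       (graph (fun x => A (u x) t) (chart_at x)) (cmap (chart_at x) x)
       (dt_vec R n)) <->
  div (scale_field (fun p => (b (u p) * W b u p)^-1) (grad u)) x =
  (W b u x)^-1 * (b (A (u x) t) ^+ 2 - n%:R * derive1 b (A (u x) t)).
  move=> Ox te.
  have ut_C2 := flow_height_C2 I_open I_itv b_pos b_smooth Omega_open u_C2
    eps_gt0 A_flow te.
  have ut_I := flow_height_I A_flow te.
  (* [W] and [div] for [u] are traded for those of the height at time [t], to which the
     single-function equivalence applies. *)
  rewrite -(W_flow I_open I_itv b_pos b_smooth Omega_open u_C2 eps_gt0 A_flow
    te Ox).
  rewrite -(div_flow I_open I_itv b_pos b_smooth Omega_open u_C2 eps_gt0 A_flow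
    te Ox).
  exact: (mean_curvature_iff_div I_open b_pos b_smooth Omega_open ut_I ut_C2
    (Ft_nondeg t te) Ox).
by split=> sol x t Ox te; apply/pointwise => //; exact: sol.
Qed.
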